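(* Let $m,n$ be positive integers and fix $\Omega=X+iY\in\mathbb H_n$ with $X,Y$ real. Let $L_\Omega=\mathbb Z^{(m,n)}+\mathbb Z^{(m,n)}\Omega$ and $A_\Omega=\mathbb C^{(m,n)}/L_\Omega$. For $A,B\in\mathbb Z^{(m,n)}$ let $E_{\Omega;A,B}$ be the function on $A_\Omega$ induced by the $L_\Omega$-periodic function $$E_{\Omega;A,B}(Z)=e^{2\pi i\left(\sigma({}^tAU)+\sigma((B-AX)Y^{-1}\,{}^tV)\right)},\qquad Z=U+iV\in\mathbb C^{(m,n)},\ U,V\text{ real}.$$ Then $\{E_{\Omega;A,B}\mid A,B\in\mathbb Z^{(m,n)}\}$ is a complete orthonormal basis of $L^2(A_\Omega)$. Moreover one has the spectral decomposition of the Laplacian $\Delta_\Omega$ $$L^2(A_\Omega)=\bigoplus_{A,B\in\mathbb Z^{(m,n)}}\mathbb C\cdot E_{\Omega;A,B}$$ (Hilbert space direct sum, each $E_{\Omega;A,B}$ being an eigenfunction of $\Delta_\Omega$).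
   Context: $\sigma$ denotes the trace, ${}^tM$ the transpose, $\mathbb H_n$ the Siegel upper half plane of symmetric complex $n\times n$ matrices with positive definite imaginary part. $L^2(A_\Omega)$ is the Hilbert space of square integrable functions on $A_\Omega$ with inner product $(f,g)_\Omega=\int_{A_\Omega}f\,\overline g\,dv_\Omega$, where $dv_\Omega$ is the translation invariant volume element normalized by $\int_{A_\Omega}dv_\Omega=1$. The Laplacian is $\Delta_\Omega=\sigma\bigl(Y\,\frac{\partial}{\partial Z}\,{}^t\bigl(\frac{\partial}{\partial\overline Z}\bigr)\bigr)$, where $\frac{\partial}{\partial Z}$ (resp. $\frac{\partial}{\partial\overline Z}$) is the $n\times m$ matrix of operators whose $(l,k)$ entry is $\partial/\partial z_{kl}$ (resp. $\partial/\partial\overline z_{kl}$); that is, $\Delta_\Omega=\sum_{k=1}^m\sum_{p,q=1}^nY_{pq}\frac{\partial^2}{\partial z_{kq}\,\partial\overline z_{kp}}$. *)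

(* Defs.v *)
From HB Require Import structures.
From mathcomp Require Import all_boot all_order all_algebra.
From mathcomp Require Import finmap.
From mathcomp Require Import generic_quotient ring_quotient complex.
From mathcomp Require Import all_classical all_reals all_analysis.
From mathcomp Require Import ring.

Set Implicit Arguments.
Unset Strict Implicit.
Unset Printing Implicit Defensive.

Import Order.TTheory GRing.Theory Num.Theory.
Import numFieldNormedType.Exports.

Local Open Scope classical_set_scope.
Local Open Scope complex_scope.
Local Open Scope ring_scope.

(* The metric topology given by the modulus; without this instance the topology
   of ['M[R[i]]_(m, n)] is not inferred. *)
#[non_forgetful_inheritance]
HB.instance Definition _ (R : realType) := PseudoPointedMetric.copy R[i] R[i]^o.

Section Siegel.
Context {R : realType} {n : nat}.

Definition Re_mx {p q} (M : 'M[R[i]]_(p, q)) : 'M[R]_(p, q) :=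
  map_mx (@complex.Re R) M.
Definition Im_mx {p q} (M : 'M[R[i]]_(p, q)) : 'M[R]_(p, q) :=
  map_mx (@complex.Im R) M.

Definition posdefmx (Y : 'M[R]_n) : Prop :=
  forall v : 'cV[R]_n, v != 0 -> 0 < (v^T *m Y *m v) 0 0.

Definition siegel : set 'M[R[i]]_n :=
  [set Omega | Omega^T = Omega /\ posdefmx (Im_mx Omega)].

End Siegel.
Arguments siegel R n : clear implicits.

Section Torus.
Context {R : realType} (m : nat) {n : nat} (Omega : 'M[R[i]]_n).

Definition in_lattice (Z : 'M[R[i]]_(m, n)) : Prop :=
  exists P Q : 'M[int]_(m, n),
    Z = map_mx intr P + map_mx intr Q *m Omega.

Definition lattice : {pred 'M[R[i]]_(m, n)} := fun Z => `[< in_lattice Z >].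

Lemma lattice_zmod_closed : zmod_closed lattice.
Proof.
split=> [|_ _ /asboolP[P [Q ->]] /asboolP[P' [Q' ->]]]; apply/asboolP.
  by exists 0, 0; rewrite !raddf0 mul0mx addr0.
by exists (P - P'), (Q - Q'); rewrite !raddfB mulmxBl opprD addrACA.
Qed.
HB.instance Definition _ :=
  GRing.isZmodClosed.Build _ lattice lattice_zmod_closed.

Definition torus : Type := ring_quotient.Quotient.quot lattice.
HB.instance Definition _ := GRing.Zmodule.on torus.
HB.instance Definition _ := generic_quotient.Quotient.on torus.
HB.instance Definition _ := isPointed.Build torus 0.

Let torus_open : set (set torus) := @quotient_open 'M[R[i]]_(m, n) torus.
Let torus_openT : torus_open setT. Proof. exact: openT. Qed.
Let torus_openI U V :
  torus_open U -> torus_open V -> torus_open (U `&` V).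
Proof. exact: openI. Qed.
Let torus_open_bigcup I (f : I -> set torus) :
  (forall i, torus_open (f i)) -> torus_open (\bigcup_i f i).
Proof. by move=> fo; apply: bigcup_open => i _; exact: fo. Qed.
HB.instance Definition _ := @isOpenTopological.Build torus
  torus_open torus_openT torus_openI torus_open_bigcup.
HB.instance Definition _ :=
  Measurable.copy torus (g_sigma_algebraType (@open torus)).

End Torus.

Section TranslationInvariance.
Context {R : realType} {m n : nat} {Omega : 'M[R[i]]_n}.

Definition translation_invariant (mu : set (torus m Omega) -> \bar R) : Prop :=
  forall (a : torus m Omega) (S : set (torus m Omega)), measurable S ->
    mu [set a + x | x in S] = mu S.

End TranslationInvariance.

(* Elements of the complex Hilbert space L^2(mu) are represented by
   square integrable functions; equality in L^2(mu) is equality mu-a.e. *)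
Section L2.
Context {R : realType} {d : measure_display} {T : measurableType d}.
Variable mu : {measure set T -> \bar R}.
Implicit Types f g : T -> R[i].

Definition sq_integrable f : Prop :=
  [/\ measurable_fun setT (fun x => complex.Re (f x)),
      measurable_fun setT (fun x => complex.Im (f x)) &
      (\int[mu]_x (complex.Re (f x) ^+ 2 + complex.Im (f x) ^+ 2)%:E < +oo)%E].

Definition cintegral f : R[i] :=
  (\int[mu]_x complex.Re (f x)) +i* (\int[mu]_x complex.Im (f x)).

Definition innerL2 f g : R[i] := cintegral (fun x => f x * ((g x)^*)%C).

Definition normL2 f : R := Num.sqrt (complex.Re (innerL2 f f)).

Definition complete_orthonormal_basis (I : choiceType) (e : I -> T -> R[i]) :=
  [/\ forall i, sq_integrable (e i),
      forall i j, innerL2 (e i) (e j) = (i == j)%:R &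
      forall f, sq_integrable f -> forall eps : R, 0 < eps ->
        exists (F : {fset I}) (c : I -> R[i]),
          normL2 (fun x => f x - \sum_(i <- F) c i * e i x) < eps].

Definition closed_subspace (H : set (T -> R[i])) : Prop :=
  [/\ H `<=` sq_integrable,
      H (fun=> 0),
      forall (a : R[i]) f g, H f -> H g -> H (fun x => a * f x + g x) &
      forall f, sq_integrable f ->
        (forall eps : R, 0 < eps ->
           exists2 g, H g & normL2 (fun x => f x - g x) < eps) ->
        H f].

(* Convergence in norm along the net of finite subsets of the index type. *)
Definition sumL2 (I : choiceType) (g : I -> T -> R[i]) f : Prop :=
  forall eps : R, 0 < eps -> exists F0 : {fset I}, forall F : {fset I},
    (F0 `<=` F)%fset -> normL2 (fun x => f x - \sum_(i <- F) g i x) < eps.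

Definition hilbert_direct_sum (I : choiceType) (H : I -> set (T -> R[i])) :=
  [/\ forall i, closed_subspace (H i),
      forall i j, i != j -> forall f g, H i f -> H j g -> innerL2 f g = 0 &
      forall f, sq_integrable f ->
        exists2 g : I -> T -> R[i], forall i, H i (g i) & sumL2 g f].

Definition lineL2 (e : T -> R[i]) : set (T -> R[i]) :=
  [set f | sq_integrable f /\
           exists c : R[i], {ae mu, forall x, f x = c * e x}].

End L2.

Section Laplacian.
Context {R : realType} {m n : nat}.
Implicit Types (f : 'M[R[i]]_(m, n) -> R[i]) (D Z : 'M[R[i]]_(m, n)).

(* ['M[R[i]]_(m, n)] is viewed as a real vector space with basis the [dir_x k l]
   and [dir_y k l] below, for which the coordinates of [Z] are the real and
   imaginary parts of the [Z k l]. *)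
Definition rderivable f D Z : Prop :=
  derivable (fun t : R => complex.Re (f (Z + t%:C *: D))) 0 1 /\
  derivable (fun t : R => complex.Im (f (Z + t%:C *: D))) 0 1.

Definition rderive f D Z : R[i] :=
  derive1 (fun t : R => complex.Re (f (Z + t%:C *: D))) 0 +i*
  derive1 (fun t : R => complex.Im (f (Z + t%:C *: D))) 0.

Definition dir_x (k : 'I_m) (l : 'I_n) : 'M[R[i]]_(m, n) := delta_mx k l.
Definition dir_y (k : 'I_m) (l : 'I_n) : 'M[R[i]]_(m, n) := 'i%C *: delta_mx k l.

Fixpoint Ck (r : nat) f : Prop :=
  continuous f /\
  if r is r'.+1 then
    forall k l D, D \in [:: dir_x k l; dir_y k l] ->
      (forall Z, rderivable f D Z) /\ Ck r' (rderive f D)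
  else True.

Definition smooth f : Prop := forall r, Ck r f.

Definition d_z (k : 'I_m) (l : 'I_n) f Z : R[i] :=
  (rderive f (dir_x k l) Z - 'i%C * rderive f (dir_y k l) Z) / 2%:R.

Definition d_zbar (k : 'I_m) (l : 'I_n) f Z : R[i] :=
  (rderive f (dir_x k l) Z + 'i%C * rderive f (dir_y k l) Z) / 2%:R.

Definition laplacian (Omega : 'M[R[i]]_n) f Z : R[i] :=
  \sum_(k < m) \sum_(p < n) \sum_(q < n)
    (Im_mx Omega p q)%:C * d_z k q (d_zbar k p f) Z.

(* The Laplacian has constant coefficients, so that it commutes with
   translations; it acts on functions on the torus through their lifts. *)
Definition eigenfunction (Omega : 'M[R[i]]_n) (h : torus m Omega -> R[i]) :=
  let f := fun Z => h (\pi_(torus m Omega)%qT Z) in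
  [/\ smooth f, exists z, h z != 0 &
      exists lambda : R[i], forall Z, laplacian Omega f Z = lambda * f Z].

End Laplacian.
Arguments eigenfunction {R m n} Omega h.

Section Exponentials.
Context {R : realType} {m n : nat} (Omega : 'M[R[i]]_n).
Implicit Types (A B : 'M[int]_(m, n)) (Z : 'M[R[i]]_(m, n)).

Definition cexp (z : R[i]) : R[i] :=
  (expR (complex.Re z))%:C * (cos (complex.Im z) +i* sin (complex.Im z)).

Definition expo_phase A B Z : R :=
  let X := Re_mx Omega in let Y := Im_mx Omega in
  let U := Re_mx Z in let V := Im_mx Z in
  let A' : 'M[R]_(m, n) := map_mx intr A in
  let B' : 'M[R]_(m, n) := map_mx intr B in
  \tr (A'^T *m U) + \tr ((B' - A' *m X) *m invmx Y *m V^T).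

Definition expo A B Z : R[i] := cexp (2%:R * pi%:C * 'i%C * (expo_phase A B Z)%:C).

(* The function induced on the torus: [expo_lattice] and [torus_expoE] below
   show that the choice of representative is immaterial. *)
Definition torus_expo A B (z : torus m Omega) : R[i] := expo A B (repr z).

Lemma posdefmx_unit (Y : 'M[R]_n) : posdefmx Y -> Y \in unitmx.
Proof.
move=> Ypos; rewrite unitmxE unitfE; apply/det0P => -[v v0 vY].
have vT0 : v^T != 0 by rewrite trmx_eq0.
by have := Ypos _ vT0; rewrite trmxK vY mul0mx mxE ltxx.
Qed.

Lemma ReD (x y : R[i]) : complex.Re (x + y) = complex.Re x + complex.Re y.
Proof. by case: x y => [? ?] [? ?]. Qed.

Lemma ImD (x y : R[i]) : complex.Im (x + y) = complex.Im x + complex.Im y.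
Proof. by case: x y => [? ?] [? ?]. Qed.

Lemma intrC (k : int) : (k%:~R : R[i]) = (k%:~R : R)%:C.
Proof. by rewrite rmorph_int. Qed.

Lemma Re_mx_lattice (Z : 'M[R[i]]_(m, n)) (P Q : 'M[int]_(m, n)) :
  Re_mx (Z + (map_mx intr P + map_mx intr Q *m Omega)) =
  Re_mx Z + (map_mx intr P + map_mx intr Q *m Re_mx Omega).
Proof.
apply/matrixP => k l; rewrite !mxE !ReD intrC /=; do 2 congr (_ + _).
rewrite (big_morph _ ReD (erefl : complex.Re 0 = 0)); apply: eq_bigr => j _.
by rewrite !mxE intrC; case: (Omega j l) => a b /=; rewrite mul0r subr0.
Qed.

Lemma Im_mx_lattice (Z : 'M[R[i]]_(m, n)) (P Q : 'M[int]_(m, n)) :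
  Im_mx (Z + (map_mx intr P + map_mx intr Q *m Omega)) =
  Im_mx Z + map_mx intr Q *m Im_mx Omega.
Proof.
apply/matrixP => k l; rewrite !mxE !ImD intrC /= add0r; congr (_ + _).
rewrite (big_morph _ ImD (erefl : complex.Im 0 = 0)); apply: eq_bigr => j _.
by rewrite !mxE intrC; case: (Omega j l) => a b /=; rewrite mul0r addr0.
Qed.

Lemma expo_phase_lattice A B Z (P Q : 'M[int]_(m, n)) : siegel R n Omega ->
  expo_phase A B (Z + (map_mx intr P + map_mx intr Q *m Omega)) =
  expo_phase A B Z + (\tr (A^T *m P) + \tr (B *m Q^T))%:~R.
Proof.
move=> [OmegaT Ypos]; rewrite /expo_phase Re_mx_lattice Im_mx_lattice.
have XT : (Re_mx Omega)^T = Re_mx Omega by rewrite /Re_mx map_trmx OmegaT.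
have YT : (Im_mx Omega)^T = Im_mx Omega by rewrite /Im_mx map_trmx OmegaT.
set X := Re_mx Omega in XT *; set Y := Im_mx Omega in YT Ypos *.
have tr_int p (M : 'M[int]_p) : (\tr M)%:~R = \tr (map_mx intr M) :> R.
  by rewrite rmorph_sum; apply: eq_bigr => i _; rewrite mxE.
have trB p (M N : 'M[R]_p) : \tr (M - N) = \tr M - \tr N by rewrite linearB.
rewrite rmorphD /= !tr_int !map_mxM -!map_trmx.
rewrite !(mulmxDr, linearD) /= trmx_mul YT.
rewrite (mulmxA _ Y) mulmxKV ?posdefmx_unit // !mulmxBl !trB.
set A' := map_mx intr A; set Q' := map_mx intr Q.
have -> : \tr (A'^T *m (Q' *m X)) = \tr (A' *m X *m Q'^T).
  rewrite -mxtrace_tr !trmx_mul trmxK XT -mulmxA mxtrace_mulC.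
  by rewrite -mulmxA mxtrace_mulC.
by ring.
Qed.

Lemma expo_lattice A B Z w : siegel R n Omega -> w \in lattice Omega ->
  expo A B (Z + w) = expo A B Z.
Proof.
move=> HOmega /asboolP[P [Q ->]]; rewrite /expo expo_phase_lattice //.
move: (expo_phase A B Z) (_ + _ : int) => x k.
have expE (y : R) : cexp (2%:R * pi%:C * 'i%C * y%:C) =
    cos (y * (pi *+ 2)) +i* sin (y * (pi *+ 2)) :> R[i].
  have -> : 2%:R * pi%:C * 'i%C * y%:C = 0 +i* (y * (pi *+ 2)) :> R[i].
    rewrite -(rmorph_nat (real_complex R)) /=; simpc; congr (_ +i* _); ring.
  by rewrite /cexp /= expR0 mul1r.
have cosK (j : nat) y : cos (y + (pi *+ 2) *+ j) = cos y :> R.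
  exact: (periodicn (@cosD2pi R)).
have sinK (j : nat) y : sin (y + (pi *+ 2) *+ j) = sin y :> R.
  exact: (periodicn (@sinD2pi R)).
rewrite !expE; case: (intP k) => [|j|j].
- by rewrite addr0.
- have -> : (x + j.+1%:~R) * (pi *+ 2) = x * (pi *+ 2) + (pi *+ 2) *+ j.+1.
    by rewrite mulrDl -pmulrn mulr_natl.
  by rewrite cosK sinK.
- have -> : x * (pi *+ 2) = (x + (- (j.+1)%:Z)%:~R) * (pi *+ 2) + (pi *+ 2) *+ j.+1.
    by rewrite mulrDl mulrNz mulNr -pmulrn mulr_natl subrK.
  by rewrite cosK sinK.
Qed.

Lemma torus_expoE A B Z : siegel R n Omega ->
  torus_expo A B (\pi_(torus m Omega)%qT Z) = expo A B Z.
Proof.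
move=> HOmega; rewrite /torus_expo -[in RHS](subrK (repr (\pi_(torus m Omega)%qT Z)) Z).
rewrite [in RHS]addrC expo_lattice //.
by rewrite ring_quotient.Quotient.idealrBE reprK.
Qed.

End Exponentials.
Arguments torus_expo {R m n} Omega A B z.

(* Main.v *)
(* The characters are orthonormal because translating by a point where a
   nontrivial character takes the value -1 changes the sign of its integral.
   For completeness, the sets whose indicator function is an L^2 limit of
   real trigonometric polynomials form a sigma-algebra: products and bounded
   pointwise limits stay in the closure. It contains the superlevel sets of
   trigonometric polynomials, hence the boxes in the lattice coordinates;
   those with rational data form a countable base, so that it contains every
   Borel set. The direct sum decomposition then follows from the best
   approximation property of Fourier coefficients, and the characters are
   eigenfunctions because every real directional derivative multiplies them
   by a constant. *)
Require Import Defs.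
From HB Require Import structures.
From mathcomp Require Import all_boot all_order all_algebra.
From mathcomp Require Import finmap complex ring lra.
From mathcomp Require Import all_classical all_reals all_analysis.
From mathcomp Require Import measurable_realfun.

Set Implicit Arguments.
Unset Strict Implicit.
Unset Printing Implicit Defensive.

Import Order.TTheory GRing.Theory Num.Theory.
Import numFieldNormedType.Exports.

Local Open Scope classical_set_scope.
Local Open Scope complex_scope.
Local Open Scope ring_scope.

(** * Density in L^2 of an algebra of bounded functions *)

Section SquareNorm.
Context {R : realType} {d : measure_display} {T : measurableType d}.
Variable mu : {measure set T -> \bar R}.
Implicit Types f g p q : T -> R.

(** Passing from functions to sets needs an order, hence the restriction to real trigonometric
    polynomials; complex functions are recovered at the end from real and imaginary parts. Closure
    under products is the delicate point, since $L^2$ is not an algebra: it holds because one factor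
    is bounded and the approximant of the other factor is bounded as well. Writing $Z=a+b\Omega$
    with real $a,b$ turns the phase into $\sigma({}^tAa)+\sigma(B\,{}^tb)$, so the characters whose
    index has a single nonzero entry, equal to 1, read off the entries of $a$ and $b$ modulo 1. A
    box is thus a finite intersection of superlevel sets of such characters. Since they see
    coordinates only modulo integers, comparing two points of a box ends with a correction by a
    lattice vector. *)

Definition sqnorm f : \bar R := (\int[mu]_x ((f x) ^+ 2)%:E)%E.

Lemma sqnorm_ge0 f : (0 <= sqnorm f)%E.
Proof. by apply: integral_ge0 => x _; rewrite lee_fin sqr_ge0. Qed.

Lemma measurable_sq f : measurable_fun setT f ->
  measurable_fun setT (fun x => ((f x) ^+ 2)%:E : \bar R).
Proof. by move=> mf; apply/measurable_EFinP; exact: measurable_funX. Qed.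

(** The pointwise bound $(a+b)^2\le 2(a^2+b^2)$ replaces the triangle inequality; it can be
    integrated directly in the extended reals, without square roots. *)
Lemma sqnormD f g : measurable_fun setT f -> measurable_fun setT g ->
  (sqnorm (fun x => f x + g x)%R <= 2%:E * (sqnorm f + sqnorm g))%E.
Proof.
move=> mf mg; rewrite /sqnorm -ge0_integralD //; last 4 first.
- by move=> x _; rewrite lee_fin sqr_ge0.
- exact: measurable_sq.
- by move=> x _; rewrite lee_fin sqr_ge0.
- exact: measurable_sq.
rewrite -ge0_integralZl //; last 2 first.
- by apply: emeasurable_funD; exact: measurable_sq.
- by move=> x _; rewrite adde_ge0 // lee_fin sqr_ge0.
apply: ge0_le_integral => //.
- by move=> x _; rewrite lee_fin sqr_ge0.
- by apply/measurable_sq; exact: measurable_funD.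
- apply: emeasurable_funM; first exact: measurable_cst.
  by apply: emeasurable_funD; exact: measurable_sq.
- move=> x _; rewrite -EFinD -EFinM lee_fin.
  have := sqr_ge0 (f x - g x); nra.
Qed.

Lemma sqnormM f g (M : R) : measurable_fun setT f -> measurable_fun setT g ->
  (forall x, `|g x| <= M) ->
  (sqnorm (fun x => f x * g x)%R <= (M ^+ 2)%:E * sqnorm f)%E.
Proof.
move=> mf mg gM; rewrite /sqnorm -ge0_integralZl //; last 3 first.
- exact: measurable_sq.
- by move=> x _; rewrite lee_fin sqr_ge0.
- by rewrite lee_fin sqr_ge0.
apply: ge0_le_integral => //.
- by move=> x _; rewrite lee_fin sqr_ge0.
- by apply/measurable_sq; exact: measurable_funM.
- apply: emeasurable_funM; first exact: measurable_cst.
  exact: measurable_sq.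
- move=> x _; rewrite -EFinM lee_fin exprMn mulrC ler_wpM2r ?sqr_ge0 //.
  rewrite -[leLHS]real_normK ?num_real //.
  by rewrite ler_sqr ?nnegrE // (le_trans _ (gM x)).
Qed.

(** Domination is put on the squared error rather than on the functions: [G] will be a constant for
    uniformly bounded sequences, and $f^2$ for simple functions increasing to $f\ge 0$. *)
Lemma sqnorm_dominated_cvg (f_ : (T -> R)^nat) f (G : T -> R) :
  (forall k, measurable_fun setT (f_ k)) -> measurable_fun setT f ->
  (forall x, f_ ^~ x @ \oo --> f x) ->
  mu.-integrable setT (EFin \o G) ->
  (forall k x, (f x - f_ k x) ^+ 2 <= G x) ->
  forall eps : R, 0 < eps -> exists k, (sqnorm (fun x => f x - f_ k x)%R < eps%:E)%E.
Proof.
move=> mf_ mf ff iG fG eps eps0.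
have cv0 : {ae mu, forall x, setT x ->
    ((f x - f_ k x) ^+ 2)%:E @[k --> \oo] --> (0 : \bar R)}.
  apply/aeW => x _; apply/cvg_EFin; first exact: nearW.
  rewrite /comp /= [X in _ --> X](_ : _ = (f x - f x) * (f x - f x));
    last by rewrite subrr mulr0.
  under eq_fun do rewrite expr2.
  by apply: cvgM; apply: cvgB (ff x); exact: cvg_cst.
have dom : {ae mu, forall x k, setT x ->
    (`|((f x - f_ k x) ^+ 2)%:E| <= (EFin \o G) x)%E}.
  by apply/aeW => x k _ /=; rewrite lee_fin ger0_norm ?sqr_ge0.
have [_ _] := dominated_convergence measurableT
  (fun k => measurable_sq (measurable_funB mf (mf_ k))) (measurable_cst _)
  cv0 iG dom.
rewrite /= integral0 => cv.
have /cv : nbhs (0%E : \bar R) [set y | (y < eps%:E)%E].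
  by apply: open_nbhs_nbhs; split; [exact: open_ereal_lt_ereal|rewrite /= lte_fin].
by move=> [k _ /(_ k (leqnn _))] ?; exists k.
Qed.

End SquareNorm.

Section L2Density.
Context {R : realType} {d : measure_display} {T : measurableType d}.
Variable mu : {finite_measure set T -> \bar R}.
Implicit Types f g p q : T -> R.

Variable A : set (T -> R).

(** The tolerance bounds the squared norm, which defines the same closure as the norm itself. *)
Definition L2_closure : set (T -> R) := [set f : T -> R | measurable_fun setT f /\
  forall eps : R, 0 < eps ->
    exists2 p, A p & (sqnorm mu (fun x => f x - p x)%R < eps%:E)%E].

Definition bounded_algebra : Prop :=
  [/\ forall c : R, A (fun=> c),
      forall p q, A p -> A q -> A (fun x => p x + q x),
      forall p q, A p -> A q -> A (fun x => p x * q x),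
      forall p, A p -> measurable_fun setT p &
      forall p, A p -> exists M : R, forall x, `|p x| <= M].

Hypothesis algA : bounded_algebra.

Let A_cst (c : R) : A (fun=> c).
Proof. by case: algA. Qed.

Let A_add p q : A p -> A q -> A (fun x => p x + q x).
Proof. by case: algA => _ + _ _ _; exact. Qed.

Let A_mul p q : A p -> A q -> A (fun x => p x * q x).
Proof. by case: algA => _ _ + _ _; exact. Qed.

Let A_meas p : A p -> measurable_fun setT p.
Proof. by case: algA => _ _ _ + _; exact. Qed.

Let A_bounded p : A p -> exists M : R, forall x, `|p x| <= M.
Proof. by case: algA => _ _ _ _; exact. Qed.

Lemma L2_closure_sub : A `<=` L2_closure.
Proof.
move=> p Ap; split=> [|eps eps0]; first exact: A_meas.
exists p => //; rewrite /sqnorm; under eq_integral do rewrite subrr expr0n.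
by rewrite integral0 lte_fin.
Qed.

Lemma L2_closure_cst (c : R) : L2_closure (fun=> c).
Proof. exact/L2_closure_sub/A_cst. Qed.

Lemma L2_closure_closed f : measurable_fun setT f ->
  (forall eps : R, 0 < eps ->
    exists2 g, L2_closure g & (sqnorm mu (fun x => f x - g x)%R < eps%:E)%E) ->
  L2_closure f.
Proof.
move=> mf H; split=> // eps eps0.
(* A quarter each, because [sqnormD] doubles the sum of the two errors. *)
have e4 : 0 < eps / 4 by rewrite divr_gt0.
have [g [mg /(_ _ e4)[p Ap gp]] fg] := H _ e4.
exists p => //.
have -> : (fun x => f x - p x) = (fun x => (f x - g x) + (g x - p x)).
  by apply/funext => x; rewrite addrA subrK.
apply: le_lt_trans (sqnormD _ _ _) _; [exact: measurable_funB|
  by apply: measurable_funB => //; exact: A_meas|].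
rewrite [ltRHS](_ : _ = 2%:E * ((eps/4)%:E + (eps/4)%:E))%E.
  by rewrite lte_pmul2l ?lte_fin ?fin_num_fun ?lteD.
by rewrite -EFinD -EFinM; congr EFin; field.
Qed.

Lemma L2_closureD f g :
  L2_closure f -> L2_closure g -> L2_closure (fun x => f x + g x).
Proof.
move=> [mf Hf] [mg Hg]; split; first exact: measurable_funD.
move=> eps eps0.
have e4 : 0 < eps / 4 by rewrite divr_gt0.
have [p Ap fp] := Hf _ e4; have [q Aq gq] := Hg _ e4.
exists (fun x => p x + q x); first exact: A_add.
have -> : (fun x => f x + g x - (p x + q x)) =
          (fun x => (f x - p x) + (g x - q x)).
  by apply/funext => x; rewrite opprD addrACA.
apply: le_lt_trans (sqnormD _ _ _) _; [by apply: measurable_funB => //; exact: A_meas..|].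
rewrite [ltRHS](_ : _ = 2%:E * ((eps/4)%:E + (eps/4)%:E))%E.
  by rewrite lte_pmul2l ?lte_fin ?fin_num_fun ?lteD.
by rewrite -EFinD -EFinM; congr EFin; field.
Qed.

(** From $fg-pq=(f-p)g+(g-q)p$: the first term is controlled by the bound on $g$, the second by a
    bound on $p$. Hence $p$ is chosen first, and the tolerance for $q$ depends on it. *)
Lemma L2_closureM f g (M : R) : (forall x, `|g x| <= M) ->
  L2_closure f -> L2_closure g -> L2_closure (fun x => f x * g x).
Proof.
move=> gM [mf Hf] [mg Hg]; split; first exact: measurable_funM.
move=> eps eps0.
(* Multiplying by a function bounded by $N$ costs a factor $N^2$; the added 1 keeps the denominator
   positive when $N=0$. *)
have d0 (N : R) : 0 < eps / 4 / (N ^+ 2 + 1).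
  by rewrite !divr_gt0 // ltr_wpDl ?sqr_ge0.
have [p Ap fp] := Hf _ (d0 M).
have [M' pM] := A_bounded Ap.
have [q Aq gq] := Hg _ (d0 M').
exists (fun x => p x * q x); first exact: A_mul.
have mp := A_meas Ap; have mq := A_meas Aq.
have -> : (fun x => f x * g x - p x * q x) =
          (fun x => (f x - p x) * g x + (g x - q x) * p x).
  by apply/funext => x; ring.
apply: le_lt_trans (sqnormD _ _ _) _;
  [by apply: measurable_funM => //; exact: measurable_funB..|].
have bd (N : R) (h k : T -> R) : measurable_fun setT h -> measurable_fun setT k ->
   (forall x, `|k x| <= N) -> (sqnorm mu h < (eps / 4 / (N ^+ 2 + 1))%:E)%E ->
   (sqnorm mu (fun x => h x * k x)%R < (eps / 4)%:E)%E.
  move=> mh mk kN hN; apply: le_lt_trans (sqnormM mu mh mk kN) _.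
  have N0 : 0 < N ^+ 2 + 1 by rewrite ltr_wpDl ?sqr_ge0.
  apply: (@le_lt_trans _ _ ((N ^+ 2)%:E * (eps / 4 / (N ^+ 2 + 1))%:E)%E).
    by rewrite lee_wpmul2l ?lee_fin ?sqr_ge0 // ltW.
  rewrite -EFinM lte_fin mulrCA gtr_pMr ?divr_gt0 //.
  by rewrite ltr_pdivrMr // mul1r ltrDl.
have mfp : measurable_fun setT (fun x => f x - p x) by exact: measurable_funB.
have mgq : measurable_fun setT (fun x => g x - q x) by exact: measurable_funB.
rewrite [ltRHS](_ : _ = 2%:E * ((eps/4)%:E + (eps/4)%:E))%E.
  by rewrite lte_pmul2l ?lte_fin ?fin_num_fun // lteD //; [exact: (bd M)|exact: (bd M')].
by rewrite -EFinD -EFinM; congr EFin; field.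
Qed.

Lemma L2_closureZ (c : R) f : L2_closure f -> L2_closure (fun x => c * f x).
Proof.
move=> Hf; under eq_fun do rewrite mulrC.
by apply: (@L2_closureM _ _ `|c|) => //; exact: L2_closure_cst.
Qed.

Lemma L2_closureB f g :
  L2_closure f -> L2_closure g -> L2_closure (fun x => f x - g x).
Proof.
move=> Hf Hg; under eq_fun do rewrite -mulN1r.
by apply: L2_closureD => //; exact: L2_closureZ.
Qed.

(** The squared error is at most $(2M)^2$, a constant, which is integrable because the measure is
    finite. *)
Lemma L2_closure_bounded_lim (f_ : (T -> R)^nat) f (M : R) :
  (forall k, L2_closure (f_ k)) -> (forall k x, `|f_ k x| <= M) ->
  (forall x, f_ ^~ x @ \oo --> f x) -> L2_closure f.
Proof.
move=> Hf_ fM ff.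
have mf_ k : measurable_fun setT (f_ k) by have [] := Hf_ k.
have mf : measurable_fun setT f.
  by apply: (measurable_fun_cvg mf_) => x _; exact: ff.
apply: L2_closure_closed => // eps eps0.
have M0 (x : T) : 0 <= M by rewrite (le_trans _ (fM 0%N x)).
have fM' (x : T) : `|f x| <= M.
  apply: (@closed_cvg _ _ _ eventually_filter (f_ ^~ x) [set y | `|y| <= M]) => //; last first.
    by apply: nearW => k /=.
  rewrite (_ : mkset _ = [set y : R | - M <= y] `&` [set y | y <= M]).
    by apply: closedI; [exact: closed_ge|exact: closed_le].
  by apply/seteqP; split=> y /=; rewrite ler_norml => /andP.
have iG : mu.-integrable setT (EFin \o (fun=> (2 * M) ^+ 2)).
  exact: finite_measure_integrable_cst.
have [|k kP] := sqnorm_dominated_cvg mf_ mf ff iG _ eps0.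
  move=> k x; rewrite -[leLHS]real_normK ?num_real //.
  rewrite ler_sqr ?nnegrE ?mulr_ge0 ?(M0 x) //.
  by rewrite (le_trans (ler_normB _ _)) // mulr_natl mulr2n lerD.
by exists (f_ k).
Qed.

(** * The sigma-algebra of approximable sets *)

Definition L2_sets : set (set T) := [set S | L2_closure (\1_S : T -> R)].

Lemma L2_setsC S : L2_sets S -> L2_sets (~` S).
Proof.
rewrite /L2_sets /= => HS.
rewrite (_ : \1_(~` S) = (fun x => 1 - \1_S x)).
  by apply: L2_closureB => //; exact: L2_closure_cst.
by apply/funext => x; rewrite !indicE in_setC; case: (_ \in _); rewrite ?subrr ?subr0.
Qed.

Lemma L2_setsI S S' : L2_sets S -> L2_sets S' -> L2_sets (S `&` S').
Proof.
rewrite /L2_sets /= => HS HS'; rewrite (_ : \1_(S `&` S') = (fun x => \1_S x * \1_S' x)).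
  by apply: (@L2_closureM _ _ 1) => // x; rewrite indicE; case: (_ \in _);
    rewrite ?normr0 ?normr1.
by apply/funext => x; rewrite indicI.
Qed.

Lemma L2_sets0 : L2_sets set0.
Proof. by rewrite /L2_sets /= indic0; exact: L2_closure_cst. Qed.

Lemma L2_setsU S S' : L2_sets S -> L2_sets S' -> L2_sets (S `|` S').
Proof.
move=> HS HS'; rewrite -[_ `|` _]setCK setCU.
by apply/L2_setsC/L2_setsI; exact: L2_setsC.
Qed.

(** At each point the indicators of the finite partial unions are eventually constant, and they are
    bounded by 1, so the bounded limit lemma applies. *)
Lemma L2_sets_bigcup (F : (set T)^nat) :
  (forall k, L2_sets (F k)) -> L2_sets (\bigcup_k F k).
Proof.
move=> HF.
have HU k : L2_sets (\big[setU/set0]_(i < k) F i).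
  by elim/big_ind: _ => //; [exact: L2_sets0|exact: L2_setsU].
apply: (L2_closure_bounded_lim HU (M := 1)) => [k x|x].
  by rewrite indicE; case: (_ \in _); rewrite ?normr0 ?normr1.
apply: cvg_near_cst; rewrite indicE.
have [[i _ Fi]|nF] := pselect ((\bigcup_k F k) x).
- rewrite mem_set; last by exists i.
  exists i.+1 => // k /= ik; rewrite indicE mem_set // -bigcup_mkord.
  by exists i.
- rewrite memNset //; apply: nearW => k; rewrite indicE memNset // -bigcup_mkord.
  by move=> [i _ Fi]; apply: nF; exists i.
Qed.

Lemma sigma_algebra_L2_sets : sigma_algebra setT L2_sets.
Proof.
split; [exact: L2_sets0|by move=> S HS; rewrite setTD; exact: L2_setsC|].
exact: L2_sets_bigcup.
Qed.

(** * Thresholding by a polynomial iteration *)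

Definition smoothstep (t : R) : R := t ^+ 2 * (3 - 2 * t).

(** This symmetry about $1/2$ lets convergence to 1 above $1/2$ follow from convergence to 0 below
    it. *)
Lemma smoothstepC t : smoothstep (1 - t) = 1 - smoothstep t.
Proof. by rewrite /smoothstep; ring. Qed.

Lemma smoothstep_itv t : 0 <= t <= 1 -> 0 <= smoothstep t <= 1.
Proof.
rewrite /smoothstep => /andP[t0 t1]; apply/andP; split.
  by rewrite mulr_ge0 ?sqr_ge0 //; lra.
rewrite -subr_ge0 (_ : _ - _ = (1 - t) ^+ 2 * (1 + 2 * t)); last by ring.
by rewrite mulr_ge0 ?sqr_ge0 //; lra.
Qed.

Lemma iter_smoothstep_itv k t : 0 <= t <= 1 -> 0 <= iter k smoothstep t <= 1.
Proof. by move=> t01; elim: k => //= k; exact: smoothstep_itv. Qed.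

Lemma iter_smoothstepC k t :
  iter k smoothstep (1 - t) = 1 - iter k smoothstep t.
Proof. by elim: k => //= k ->; rewrite smoothstepC. Qed.

(** One step multiplies $u$ by $u(3-2u)$, which is increasing on $[0,1/2]$ and equals 1 at $1/2$. As
    long as $u\le t<1/2$ this factor is at most $q=t(3-2t)<1$, so the decay is geometric. *)
Lemma iter_smoothstep_lt t : 0 <= t < 2^-1 ->
  iter k smoothstep t @[k --> \oo] --> 0.
Proof.
move=> /andP[t0 t2].
pose q := t * (3 - 2 * t).
have q0 : 0 <= q by rewrite /q; nra.
have q1 : q < 1 by rewrite /q; nra.
have bd k : 0 <= iter k smoothstep t <= t * q ^+ k.
  have qk : 0 <= q ^+ k <= 1 by rewrite exprn_ge0 // exprn_ile1 // ltW.
  elim: k {qk} => [|k /andP[u0 ut]] /=; first by rewrite t0 mulr1 lexx.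
  have qk : 0 <= q ^+ k <= 1 by rewrite exprn_ge0 // exprn_ile1 // ltW.
  case/andP: qk => qk0 qk1.
  set u := iter _ _ _ in u0 ut *.
  have ut' : u <= t by rewrite (le_trans ut) // ler_piMr.
  rewrite exprSr mulrA /smoothstep; apply/andP; split; first by nra.
  have -> : u ^+ 2 * (3 - 2 * u) = u * (u * (3 - 2 * u)) by ring.
  have uq : u * (3 - 2 * u) <= q by rewrite /q; nra.
  by apply: ler_pM => //; nra.
apply: (@squeeze_cvgr _ _ _ _ (fun=> 0) (fun k => t * q ^+ k)).
- exact: nearW.
- exact: cvg_cst.
- rewrite -[X in _ --> X](mulr0 t); apply: cvgMr.
  by apply: cvg_expr; rewrite ger0_norm.
Qed.

(* The iterates of [3t^2 - 2t^3], for which [0] and [1] attract everything but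
   the fixed point [1/2], turn a function into a threshold using only polynomials. *)
Lemma L2_sets_gt_half g : L2_closure g -> (forall x, 0 <= g x <= 1) ->
  L2_sets [set x | 2^-1 < g x].
Proof.
move=> Hg g01.
have Hs f : (forall x, 0 <= f x <= 1) -> L2_closure f ->
    L2_closure (fun x => smoothstep (f x)).
  move=> f01 Hf.
  have f1 x : `|f x| <= 1 by have /andP[f0 ?] := f01 x; rewrite ger0_norm.
  rewrite (_ : (fun x => _) = (fun x => (3 - 2 * f x) * f x * f x)).
    apply: (L2_closureM f1) => //; apply: (L2_closureM f1) => //.
    by apply: L2_closureB; [exact: L2_closure_cst|exact: L2_closureZ].
  by apply/funext => x; rewrite /smoothstep; ring.
have Hi k : L2_closure (fun x => iter k smoothstep (g x)).
  elim: k => //= k IH; apply: (Hs (fun x => iter k smoothstep (g x))) => // x.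
  exact: iter_smoothstep_itv.
(* The pointwise limit of the iterates; the middle value comes from the fixed point $1/2$. *)
pose h x : R := if g x < 2^-1 then 0 else if g x == 2^-1 then 2^-1 else 1.
have h1 x : `|h x| <= 1.
  rewrite /h; case: ifP => _; first by rewrite normr0.
  case: ifP => _; last by rewrite normr1.
  by rewrite ger0_norm ?invr_ge0 // invf_le1 // ler1n.
have Hh : L2_closure h.
  apply: (L2_closure_bounded_lim Hi (M := 1)) => [k x|x].
    by have /andP[? ?] := iter_smoothstep_itv k (g01 x); rewrite ger0_norm.
  rewrite /h; have /andP[g0 g1] := g01 x.
  case: (ltrgtP (g x) 2^-1) => gx.
  - by apply: iter_smoothstep_lt; rewrite g0.
  - have -> : (fun k => iter k smoothstep (g x)) =
        (fun k => 1 - iter k smoothstep (1 - g x)).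
      by apply/funext => k; rewrite iter_smoothstepC opprB addrC subrK.
    rewrite -[X in _ --> X]subr0; apply: cvgB; first exact: cvg_cst.
    by apply: iter_smoothstep_lt; lra.
  - apply: cvg_near_cst; apply: nearW => k; rewrite gx.
    elim: k => //= k ->; rewrite /smoothstep.
    by field.
(* The polynomial $2h^2-h$ sends $0,1/2,1$ to $0,0,1$: it discards the level set $g=1/2$ and leaves
   the strict superlevel set. *)
rewrite /L2_sets /= (_ : \1__ = (fun x => 2 * (h x * h x) - h x)).
  by apply: L2_closureB => //; apply: L2_closureZ; exact: (L2_closureM h1).
apply/funext => x; rewrite indicE /h.
case: (ltrgtP (g x) 2^-1) => gx.
- by rewrite memNset /= ?mulr0 ?subrr //= => gt; move: (lt_trans gx gt); rewrite ltxx.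
- by rewrite mem_set //= !mulr1 [2]mulr2n addrK.
- by rewrite memNset /= ?gx ?ltxx //; field.
Qed.

(** * From generating sets to all square integrable functions *)

Lemma measurable_L2_sets (G : set (set T)) :
  @measurable _ T `<=` <<s G >> -> G `<=` L2_sets -> @measurable _ T `<=` L2_sets.
Proof.
move=> mG GL S /mG; apply: smallest_sub => //; exact: sigma_algebra_L2_sets.
Qed.

Import HBNNSimple.

(** A nonnegative $f$ is a limit of simple functions $0\le f_k\le f$, with squared error dominated
    by $f^2$; a general $f$ is the difference of its positive and negative parts. *)
Lemma L2_closureT : @measurable _ T `<=` L2_sets ->
  forall f, measurable_fun setT f -> (sqnorm mu f < +oo)%E -> L2_closure f.
Proof.
move=> mL.
have Hnn f : (forall x, 0 <= f x) -> measurable_fun setT f ->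
    (sqnorm mu f < +oo)%E -> L2_closure f.
  move=> f0 mf f2; apply: L2_closure_closed => // eps eps0.
  have mEf : measurable_fun setT (EFin \o f) by exact/measurable_EFinP.
  have Ef0 x : setT x -> (0 <= (EFin \o f) x)%E by rewrite lee_fin.
  pose f_ : (T -> R)^nat := nnsfun_approx measurableT mEf.
  have f_le k x : 0 <= f_ k x <= f x.
    rewrite /f_ fun_ge0 /= -lee_fin nnsfun_approxE.
    exact: (le_approx k Ef0).
  have ff x : f_ ^~ x @ \oo --> f x.
    by have /fine_cvgP[_] := cvg_nnsfun_approx measurableT mEf Ef0 (x := x) I.
  have mf_ k : measurable_fun setT (f_ k) by exact: measurable_funPT.
  have if2 : mu.-integrable setT (EFin \o (fun x => f x ^+ 2)).
    apply/integrableP; split; first exact: measurable_sq.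
    by under eq_integral do rewrite /= ger0_norm ?sqr_ge0 //.
  have [k x|k kP] := sqnorm_dominated_cvg mf_ mf ff if2 _ eps0.
    by have /andP[a b] := f_le k x; nra.
  exists (f_ k) => //.
  rewrite (_ : f_ k = fun x => \sum_(y <- fset_set (range (f_ k)))
      (y * \1_(f_ k @^-1` [set y]) x)); last first.
    by apply/funext => x; rewrite /f_ [LHS]fimfunE fsbig_finite.
  have sumC (s : seq R) (F : R -> T -> R) : (forall y, L2_closure (F y)) ->
      L2_closure (fun x => \sum_(y <- s) F y x).
    move=> HF; elim: s => [|y s IH].
      by under eq_fun do rewrite big_nil; exact: L2_closure_cst.
    by under eq_fun do rewrite big_cons; exact: L2_closureD.
  apply: (sumC _ (fun y x => y * \1_(f_ k @^-1` [set y]) x)) => y.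
  by apply/L2_closureZ/mL; exact: measurable_sfunP.
move=> f mf f2.
rewrite (_ : f = (fun x => 2^-1 * (`|f x| + f x) - 2^-1 * (`|f x| - f x))); last first.
  by apply/funext => x; field.
have mn : measurable_fun setT (fun x => `|f x|) by exact: measurableT_comp.
have le2 g : measurable_fun setT g -> (forall x, g x ^+ 2 <= f x ^+ 2) ->
    (sqnorm mu g < +oo)%E.
  move=> mg gf; apply: le_lt_trans f2; apply: ge0_le_integral => //.
  - by move=> x _; rewrite lee_fin sqr_ge0.
  - exact: measurable_sq.
  - exact: measurable_sq.
  - by move=> x _; rewrite lee_fin.
apply: L2_closureB; apply: Hnn.
- by move=> x; rewrite mulr_ge0 // -lerBlDr sub0r -normrN ler_norm.
- by apply: measurable_funM; [exact: measurable_cst|exact: measurable_funD].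
- apply: le2.
    by apply: measurable_funM; [exact: measurable_cst|exact: measurable_funD].
  move=> x; rewrite -(real_normK (num_real (f x))).
  have := ler_norm (f x); have := lerNnormlW (lexx `|f x|); nra.
- by move=> x; rewrite mulr_ge0 // subr_ge0; exact: ler_norm.
- by apply: measurable_funM; [exact: measurable_cst|exact: measurable_funB].
- apply: le2.
    by apply: measurable_funM; [exact: measurable_cst|exact: measurable_funB].
  move=> x; rewrite -(real_normK (num_real (f x))).
  have := ler_norm (f x); have := lerNnormlW (lexx `|f x|); nra.
Qed.

End L2Density.

(** * The Hilbert space of complex square integrable functions *)

Section L2Space.
Context {R : realType} {d : measure_display} {T : measurableType d}.
Variable mu : {measure set T -> \bar R}.
Implicit Types f g h : T -> R[i].
Local Notation Re := (@complex.Re R).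
Local Notation Im := (@complex.Im R).

Definition cintegrable h : Prop :=
  mu.-integrable setT (EFin \o (fun x => Re (h x))) /\
  mu.-integrable setT (EFin \o (fun x => Im (h x))).

Lemma cintegralD f g : cintegrable f -> cintegrable g ->
  cintegral mu (fun x => f x + g x) = cintegral mu f + cintegral mu g.
Proof.
move=> [fR fI] [gR gI]; rewrite /cintegral.
under eq_Rintegral do rewrite ReD.
under [X in _ +i* X]eq_Rintegral do rewrite ImD.
by rewrite !RintegralD.
Qed.

Lemma ReM (a b : R[i]) : Re (a * b) = Re a * Re b - Im a * Im b.
Proof. by case: a b => [? ?] [? ?]. Qed.

Lemma ImM (a b : R[i]) : Im (a * b) = Re a * Im b + Im a * Re b.
Proof. by case: a b => [? ?] [? ?]. Qed.

Lemma cintegrableZ (a : R[i]) f : cintegrable f -> cintegrable (fun x => a * f x).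
Proof.
move=> [fR fI]; split.
- under eq_fun do rewrite ReM.
  by apply: (integrableB measurableT (integrableZl measurableT (Re a) fR)
    (integrableZl measurableT (Im a) fI)).
- under eq_fun do rewrite ImM.
  by apply: (integrableD measurableT (integrableZl measurableT (Re a) fI)
    (integrableZl measurableT (Im a) fR)).
Qed.

Lemma cintegralZ (a : R[i]) f : cintegrable f ->
  cintegral mu (fun x => a * f x) = a * cintegral mu f.
Proof.
move=> [fR fI]; rewrite /cintegral.
under eq_Rintegral do rewrite ReM.
under [X in _ +i* X]eq_Rintegral do rewrite ImM.
rewrite RintegralB ?RintegralD //; last 4 first.
- exact: (integrableZl measurableT (Re a) fI).
- exact: (integrableZl measurableT (Im a) fR).
- exact: (integrableZl measurableT (Re a) fR).
- exact: (integrableZl measurableT (Im a) fI).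
by rewrite !RintegralZl //; case: a.
Qed.

Lemma cintegral_conj f : cintegrable f ->
  cintegral mu (fun x => (f x)^*%C) = (cintegral mu f)^*%C.
Proof.
move=> [fR fI]; rewrite /cintegral /=; congr (_ +i* _).
  by apply: eq_Rintegral => x _; case: (f x).
rewrite -mulN1r -RintegralZl //.
by apply: eq_Rintegral => x _; case: (f x) => ? ? /=; rewrite mulN1r.
Qed.

Lemma integrable_mul (a b : T -> R) :
  measurable_fun setT a -> measurable_fun setT b ->
  (sqnorm mu a < +oo)%E -> (sqnorm mu b < +oo)%E ->
  mu.-integrable setT (EFin \o (fun x => a x * b x)).
Proof.
move=> ma mb a2 b2.
apply: (@le_integrable _ _ _ _ _ measurableT _
  (fun x => (a x ^+ 2)%:E + (b x ^+ 2)%:E)%E).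
- by apply/measurable_EFinP; exact: measurable_funM.
- move=> x _ /=; rewrite lee_fin [leRHS]ger0_norm ?addr_ge0 ?sqr_ge0 //.
  rewrite normrM -(real_normK (num_real (a x))) -(real_normK (num_real (b x))).
  by have := sqr_ge0 (`|a x| - `|b x|); have := mulr_ge0 (normr_ge0 (a x)) (normr_ge0 (b x)); nra.
- apply: integrableD => //; apply/integrableP; split; try exact: measurable_sq;
    by under eq_integral do rewrite /= ger0_norm ?sqr_ge0 //.
Qed.

Lemma sq_integrableP f : sq_integrable mu f <->
  [/\ measurable_fun setT (fun x => Re (f x)),
      measurable_fun setT (fun x => Im (f x)),
      (sqnorm mu (fun x => Re (f x)) < +oo)%E &
      (sqnorm mu (fun x => Im (f x)) < +oo)%E].
Proof.
have sumE : measurable_fun setT (fun x => Re (f x)) ->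
    measurable_fun setT (fun x => Im (f x)) ->
    (\int[mu]_x (Re (f x) ^+ 2 + Im (f x) ^+ 2)%:E =
    sqnorm mu (fun x => Re (f x)) + sqnorm mu (fun x => Im (f x)))%E.
  move=> mR mI; under eq_integral do rewrite EFinD.
  by rewrite ge0_integralD //; try (by move=> x _; rewrite lee_fin sqr_ge0);
    exact: measurable_sq.
split=> [[mR mI]|[mR mI fR fI]]; last by split=> //; rewrite sumE // lte_add_pinfty.
rewrite sumE // => foo; split=> //; apply: le_lt_trans foo.
- by rewrite leeDl // sqnorm_ge0.
- by rewrite leeDr // sqnorm_ge0.
Qed.

Lemma cintegrable_mul_conj f g : sq_integrable mu f -> sq_integrable mu g ->
  cintegrable (fun x => f x * ((g x)^*)%C).
Proof.
move=> /sq_integrableP[mfR mfI fR fI] /sq_integrableP[mgR mgI gR gI]; split.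
- have -> : EFin \o (fun x => Re (f x * ((g x)^*)%C)) =
      (fun x => (Re (f x) * Re (g x))%:E + (Im (f x) * Im (g x))%:E)%E.
    by apply/funext => x; rewrite /= ReM -EFinD; case: (g x) => ? ? /=; rewrite mulrN opprK.
  by apply: integrableD => //; exact: integrable_mul.
- have -> : EFin \o (fun x => Im (f x * ((g x)^*)%C)) =
      (fun x => (Im (f x) * Re (g x))%:E - (Re (f x) * Im (g x))%:E)%E.
    apply/funext => x; rewrite /= ImM -EFinB; case: (g x) => ? ? /=.
    by rewrite mulrN addrC.
  by apply: integrableB => //; exact: integrable_mul.
Qed.

Lemma sq_integrable_lin (a : R[i]) f g : sq_integrable mu f -> sq_integrable mu g ->
  sq_integrable mu (fun x => a * f x + g x).
Proof.
move=> /sq_integrableP[mfR mfI fR fI] /sq_integrableP[mgR mgI gR gI].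
(* One real statement serves twice: the real part of $af+g$ uses the coefficients
   $(\mathrm{Re}\,a,-\mathrm{Im}\,a)$, the imaginary part $(\mathrm{Re}\,a,\mathrm{Im}\,a)$ with the
   two parts of $f$ exchanged. *)
have Hlin (b c : R) (u v w : T -> R) :
    measurable_fun setT u -> measurable_fun setT v -> measurable_fun setT w ->
    (sqnorm mu u < +oo)%E -> (sqnorm mu v < +oo)%E -> (sqnorm mu w < +oo)%E ->
    measurable_fun setT (fun x => (b * u x + c * v x) + w x) /\
    (sqnorm mu (fun x => (b * u x + c * v x) + w x)%R < +oo)%E.
  move=> mu_ mv mw u2 v2 w2.
  have mc (e : R) (k : T -> R) : measurable_fun setT k ->
      measurable_fun setT (fun x => e * k x).
    by move=> mk; apply: measurable_funM => //; exact: measurable_cst.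
  have sc (e : R) (k : T -> R) : measurable_fun setT k -> (sqnorm mu k < +oo)%E ->
      (sqnorm mu (fun x => e * k x)%R < +oo)%E.
    move=> mk k2; rewrite (_ : (fun x => _) = (fun x => k x * e)); last first.
      by apply/funext => x; rewrite mulrC.
    apply: le_lt_trans (sqnormM mu (g := fun=> e) (M := `|e|) mk _ _) _ => //.
    by rewrite lte_mul_pinfty // lee_fin sqr_ge0.
  have sD (k l : T -> R) : measurable_fun setT k -> measurable_fun setT l ->
      (sqnorm mu k < +oo)%E -> (sqnorm mu l < +oo)%E ->
      (sqnorm mu (fun x => k x + l x)%R < +oo)%E.
    move=> mk ml k2 l2; apply: le_lt_trans (sqnormD mu mk ml) _.
    by rewrite lte_mul_pinfty // lte_add_pinfty.
  have mbc : measurable_fun setT (fun x => b * u x + c * v x).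
    by apply: measurable_funD; exact: mc.
  split; first exact: measurable_funD.
  by apply: (sD _ _ mbc mw) => //; apply: sD; [exact: mc..|exact: sc|exact: sc].
have [H1 H2] := Hlin (Re a) (- Im a) _ _ _ mfR mfI mgR fR fI gR.
have [H3 H4] := Hlin (Re a) (Im a) _ _ _ mfI mfR mgI fI fR gI.
have RE : (fun x => Re (a * f x + g x)) =
    (fun x => Re a * Re (f x) + - Im a * Im (f x) + Re (g x)).
  by apply/funext => x; rewrite ReD ReM mulNr.
have IE : (fun x => Im (a * f x + g x)) =
    (fun x => Re a * Im (f x) + Im a * Re (f x) + Im (g x)).
  by apply/funext => x; rewrite ImD ImM.
by apply/sq_integrableP; rewrite RE IE.
Qed.

Lemma sq_integrable0 : sq_integrable mu (fun=> 0).
Proof.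
apply/sq_integrableP; split; try exact: measurable_cst;
  by rewrite /sqnorm; under eq_integral do rewrite expr0n; rewrite integral0.
Qed.

Lemma sq_integrableZ (a : R[i]) f :
  sq_integrable mu f -> sq_integrable mu (fun x => a * f x).
Proof.
move=> Hf; have := sq_integrable_lin a Hf sq_integrable0.
by under eq_fun do rewrite addr0.
Qed.

Lemma sq_integrable_sub f g : sq_integrable mu f -> sq_integrable mu g ->
  sq_integrable mu (fun x => f x - g x).
Proof.
move=> Hf Hg; have := sq_integrable_lin (-1) Hg Hf.
by under eq_fun do rewrite mulN1r addrC.
Qed.

Lemma sq_integrable_sum (I : Type) (s : seq I) (c : I -> R[i]) (e : I -> T -> R[i]) :
  (forall i, sq_integrable mu (e i)) ->
  sq_integrable mu (fun x => \sum_(i <- s) c i * e i x).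
Proof.
move=> He; elim: s => [|i s IH].
  by under eq_fun do rewrite big_nil; exact: sq_integrable0.
by under eq_fun do rewrite big_cons; exact: sq_integrable_lin.
Qed.

Lemma innerL2_linl (a : R[i]) f g h :
  sq_integrable mu f -> sq_integrable mu g -> sq_integrable mu h ->
  innerL2 mu (fun x => a * f x + g x) h = a * innerL2 mu f h + innerL2 mu g h.
Proof.
move=> Hf Hg Hh; rewrite /innerL2.
have -> : (fun x => (a * f x + g x) * ((h x)^*)%C) =
    (fun x => a * (f x * ((h x)^*)%C) + g x * ((h x)^*)%C).
  by apply/funext => x; rewrite mulrDl mulrA.
have Hfh := cintegrable_mul_conj Hf Hh.
rewrite cintegralD ?cintegralZ //; first exact: cintegrableZ.
exact: cintegrable_mul_conj.
Qed.

Lemma innerL2C f g : sq_integrable mu f -> sq_integrable mu g ->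
  innerL2 mu g f = (innerL2 mu f g)^*%C.
Proof.
move=> Hf Hg; rewrite /innerL2 -cintegral_conj; last exact: cintegrable_mul_conj.
by congr cintegral; apply/funext => x; rewrite rmorphM /= conjcK mulrC.
Qed.

Lemma innerL2_linr (a : R[i]) f g h :
  sq_integrable mu f -> sq_integrable mu g -> sq_integrable mu h ->
  innerL2 mu h (fun x => a * f x + g x) =
  a^*%C * innerL2 mu h f + innerL2 mu h g.
Proof.
move=> Hf Hg Hh; rewrite innerL2C //; last exact: sq_integrable_lin.
have conjE (u v w : R[i]) : (u * v + w)^*%C = u^*%C * v^*%C + w^*%C.
  by rewrite rmorphD rmorphM.
by rewrite innerL2_linl // conjE -!innerL2C.
Qed.

Lemma innerL20 h : sq_integrable mu h -> innerL2 mu (fun=> 0) h = 0.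
Proof.
move=> Hh; apply: (addrI (innerL2 mu (fun=> 0) h)); rewrite addr0.
have := innerL2_linl 1 sq_integrable0 sq_integrable0 Hh.
by rewrite !mul1r addr0.
Qed.

Lemma innerL20r h : sq_integrable mu h -> innerL2 mu h (fun=> 0) = 0.
Proof. by move=> Hh; rewrite innerL2C ?innerL20 ?conjc0 //; exact: sq_integrable0. Qed.

Lemma innerL2_suml (I : Type) (s : seq I) (c : I -> R[i]) (e : I -> T -> R[i]) h :
  (forall i, sq_integrable mu (e i)) -> sq_integrable mu h ->
  innerL2 mu (fun x => \sum_(i <- s) c i * e i x) h =
  \sum_(i <- s) c i * innerL2 mu (e i) h.
Proof.
move=> He Hh; elim: s => [|i s IH].
  by under eq_fun do rewrite big_nil; rewrite big_nil innerL20.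
under eq_fun do rewrite big_cons; rewrite big_cons innerL2_linl ?IH //.
exact: sq_integrable_sum.
Qed.

Lemma innerL2_sumr (I : Type) (s : seq I) (c : I -> R[i]) (e : I -> T -> R[i]) h :
  (forall i, sq_integrable mu (e i)) -> sq_integrable mu h ->
  innerL2 mu h (fun x => \sum_(i <- s) c i * e i x) =
  \sum_(i <- s) (c i)^*%C * innerL2 mu h (e i).
Proof.
move=> He Hh; elim: s => [|i s IH].
  by under eq_fun do rewrite big_nil; rewrite big_nil innerL20r.
under eq_fun do rewrite big_cons; rewrite big_cons innerL2_linr ?IH //.
exact: sq_integrable_sum.
Qed.

(** The bridge between the Hilbert space notions, whose integrals are real numbers by truncation
    with [fine], and the extended real norms of the density argument. *)
Lemma Re_innerL2 f : sq_integrable mu f -> (Re (innerL2 mu f f))%:E =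
  (sqnorm mu (fun x => Re (f x)) + sqnorm mu (fun x => Im (f x)))%E.
Proof.
move=> Hf; have [ifR _] := cintegrable_mul_conj Hf Hf.
have /sq_integrableP[mR mI fR fI] := Hf.
rewrite /= /Rintegral fineK; last exact: integrable_fin_num.
rewrite -ge0_integralD //; try (by move=> x _; rewrite lee_fin sqr_ge0);
  try exact: measurable_sq.
apply: eq_integral => x _; rewrite -EFinD ReM; congr EFin.
by case: (f x) => a b /=; ring.
Qed.

Lemma normL2_ge0 f : 0 <= normL2 mu f.
Proof. exact: sqrtr_ge0. Qed.

Lemma sqr_normL2 f : sq_integrable mu f ->
  normL2 mu f ^+ 2 = Re (innerL2 mu f f).
Proof.
move=> Hf; rewrite sqr_sqrtr // -lee_fin Re_innerL2 //.
by rewrite adde_ge0 // sqnorm_ge0.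
Qed.

Lemma normL2_le f g :
  Re (innerL2 mu f f) <= Re (innerL2 mu g g) -> normL2 mu f <= normL2 mu g.
Proof. exact: ler_wsqrtr. Qed.

(** Orthogonality makes the right side $\|f\|^2+\|g\|^2$; dropping $\|g\|^2$ leaves what best
    approximation needs. *)
Lemma innerL2_pythagoras f g : sq_integrable mu f -> sq_integrable mu g ->
  innerL2 mu f g = 0 ->
  Re (innerL2 mu f f) <=
  Re (innerL2 mu (fun x => f x + g x) (fun x => f x + g x)).
Proof.
move=> Hf Hg fg.
have E : (fun x => f x + g x) = (fun x => 1 * g x + f x).
  by apply/funext => x; rewrite mul1r addrC.
have Hs : sq_integrable mu (fun x => f x + g x) by rewrite E; exact: sq_integrable_lin.
rewrite {1}E innerL2_linl // E !innerL2_linr // fg.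
rewrite [innerL2 mu g f]innerL2C // fg !conjc1 !conjc0 !mul1r addr0 add0r ReD.
by rewrite lerDr -sqr_normL2 // sqr_ge0.
Qed.

Lemma innerL2_ae_eq f f' g g' :
  sq_integrable mu f -> sq_integrable mu f' ->
  sq_integrable mu g -> sq_integrable mu g' ->
  {ae mu, forall x, f x = f' x} -> {ae mu, forall x, g x = g' x} ->
  innerL2 mu f g = innerL2 mu f' g'.
Proof.
move=> Hf Hf' Hg Hg' ff' gg'.
have [/measurable_int mR /measurable_int mI] := cintegrable_mul_conj Hf Hg.
have [/measurable_int mR' /measurable_int mI'] := cintegrable_mul_conj Hf' Hg'.
rewrite /innerL2 /cintegral /Rintegral; congr (fine _ +i* fine _).
  by apply: ae_eq_integral => //; apply: filterS2 ff' gg' => x -> ->.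
by apply: ae_eq_integral => //; apply: filterS2 ff' gg' => x -> ->.
Qed.

Lemma normL2_ae_eq f g : sq_integrable mu f -> sq_integrable mu g ->
  {ae mu, forall x, f x = g x} -> normL2 mu f = normL2 mu g.
Proof. by move=> Hf Hg fg; rewrite /normL2 (innerL2_ae_eq Hf Hg Hf Hg fg fg). Qed.

Lemma normL2_eq0 f : sq_integrable mu f -> normL2 mu f = 0 ->
  {ae mu, forall x, f x = 0}.
Proof.
move=> Hf f0; have := Re_innerL2 Hf; rewrite -sqr_normL2 // f0 expr0n /= => /esym E.
have /sq_integrableP[mR mI fR fI] := Hf.
have z (u : T -> R) : measurable_fun setT u -> (sqnorm mu u <= 0)%E ->
    {ae mu, forall x, u x = 0}.
  move=> m_u u0.
  have /(ae_eq_integral_abs mu measurableT (measurable_sq m_u)) :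
      (\int[mu]_x `|(u x ^+ 2)%:E| = 0)%E.
    under eq_integral do rewrite gee0_abs ?lee_fin ?sqr_ge0 //.
    by apply/eqP; rewrite eq_le u0 sqnorm_ge0.
  apply: filterS => x /(_ I) /= [] /eqP.
  by rewrite sqrf_eq0 => /eqP.
have R0 := z _ mR; have I0 := z _ mI.
(* Each of two nonnegative terms is at most their sum, which is 0. *)
have {}R0 := R0 (le_trans (leeDl _ (sqnorm_ge0 mu _)) (eq_ind_r (fun z => (z <= 0)%E) (lexx 0%E) E)).
have {}I0 := I0 (le_trans (leeDr _ (sqnorm_ge0 mu _)) (eq_ind_r (fun z => (z <= 0)%E) (lexx 0%E) E)).
apply: filterS2 R0 I0 => x; by case: (f x) => a b /= -> ->.
Qed.

End L2Space.

(** * Fourier coefficients and the sum of the lines *)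

Section OrthonormalBasis.
Context {R : realType} {d : measure_display} {T : measurableType d}.
Variable mu : {measure set T -> \bar R}.
Context {I : choiceType} {e : I -> T -> R[i]}.
Hypothesis sq_e : forall i, sq_integrable mu (e i).
Hypothesis orth_e : forall i j, innerL2 mu (e i) (e j) = (i == j)%:R.

Lemma innerL2_fourier_coeff (s : seq I) (c : I -> R[i]) j : uniq s ->
  innerL2 mu (fun x => \sum_(i <- s) c i * e i x) (e j) =
  if j \in s then c j else 0.
Proof.
move=> us; rewrite innerL2_suml //; case: ifPn => js.
  rewrite (bigD1_seq j) //= orth_e eqxx mulr1 big1 ?addr0 // => i /negPf ij.
  by rewrite orth_e ij mulr0.
rewrite big_seq big1 // => i iS; rewrite orth_e.
by case: eqP => [ij|_]; [rewrite -ij iS in js|rewrite mulr0].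
Qed.

(** Split $f-S_c=(f-S_b)+S_{b-c}$ with $b$ the Fourier coefficients: the first term is orthogonal to
    every $e_i$ with $i$ in [s], hence to the second. *)
Lemma normL2_best_approx (s : seq I) (c : I -> R[i]) f : uniq s ->
  sq_integrable mu f ->
  normL2 mu (fun x => f x - \sum_(i <- s) innerL2 mu f (e i) * e i x) <=
  normL2 mu (fun x => f x - \sum_(i <- s) c i * e i x).
Proof.
move=> us Hf.
pose S a x := \sum_(i <- s) a i * e i x : R[i].
have HS a : sq_integrable mu (S a) by exact: sq_integrable_sum.
pose b i := innerL2 mu f (e i).
have Hfb : sq_integrable mu (fun x => f x - S b x) by exact: (sq_integrable_sub Hf (HS b)).
apply: normL2_le.
have -> : (fun x => f x - \sum_(i <- s) c i * e i x) =
    (fun x => (f x - S b x) + S (fun i => b i - c i) x).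
  apply/funext => x.
  have -> : S (fun i => b i - c i) x = S b x - S c x.
    by rewrite /S -sumrB; apply: eq_bigr => i _; rewrite mulrBl.
  by rewrite addrA subrK.
apply: innerL2_pythagoras => //.
rewrite innerL2_sumr // big_seq big1 // => i iS.
rewrite (_ : (fun x => f x - S b x) = (fun x => (-1) * S b x + f x)).
  by rewrite innerL2_linl // /S innerL2_fourier_coeff // iS mulN1r addNr mulr0.
by apply/funext => x; rewrite mulN1r addrC.
Qed.

(** For closedness, the coefficient of a limit $f$ must be $(f,e_i)$. By best approximation
    $\|f-(f,e_i)e_i\|$ is below the distance from $f$ to any element of the line, hence zero. *)
Lemma closed_subspace_line i : closed_subspace mu (lineL2 mu (e i)).
Proof.
split.
- by move=> f [].
- split; first exact: sq_integrable0.
  by exists 0; apply/aeW => x; rewrite mul0r.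
- move=> a f g [Hf [c fc]] [Hg [c' gc]]; split; first exact: sq_integrable_lin.
  exists (a * c + c'); apply: filterS2 fc gc => x -> ->.
  by rewrite mulrDl mulrA.
- move=> f Hf fH; split=> //; exists (innerL2 mu f (e i)).
  have Hd (c : R[i]) : sq_integrable mu (fun x => f x - c * e i x).
    by apply: sq_integrable_sub => //; exact: sq_integrableZ.
  have : normL2 mu (fun x => f x - innerL2 mu f (e i) * e i x) = 0.
    apply/eqP; rewrite eq_le normL2_ge0 andbT; apply/ler_addgt0Pr => eps eps0.
    rewrite add0r; have [g [Hg [c gc]] fg] := fH _ eps0.
    apply: le_trans (ltW fg).
    have [] := (@normL2_best_approx [:: i] (fun=> c) f isT Hf, tt) => + _.
    under eq_fun do rewrite big_seq1.
    under [X in _ <= normL2 _ X]eq_fun do rewrite big_seq1.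
    move=> /le_trans; apply.
    (* An element of the line is a multiple of $e_i$ only almost everywhere, so the two norms are
       compared through [normL2_ae_eq]. *)
    rewrite le_eqVlt; apply/orP; left; apply/eqP.
    by apply: normL2_ae_eq => //; [exact: sq_integrable_sub|];
      apply: filterS gc => x ->.
  by move=> /(normL2_eq0 (Hd _)); apply: filterS => x /eqP; rewrite subr_eq0 => /eqP.
Qed.

Lemma hilbert_direct_sum_lines : complete_orthonormal_basis mu e ->
  hilbert_direct_sum mu (fun i => lineL2 mu (e i)).
Proof.
move=> [_ _ complete]; split.
- exact: closed_subspace_line.
- move=> i j ij f g [Hf [c fc]] [Hg [c' gc]].
  rewrite (innerL2_ae_eq Hf (sq_integrableZ c (sq_e i)) Hg
    (sq_integrableZ c' (sq_e j)) fc gc).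
  have -> : (fun x => c * e i x) = (fun x => \sum_(k <- [:: i]) c * e k x).
    by apply/funext => x; rewrite big_seq1.
  have -> : (fun x => c' * e j x) = (fun x => \sum_(k <- [:: j]) c' * e k x).
    by apply/funext => x; rewrite big_seq1.
  rewrite innerL2_sumr //; last exact: sq_integrable_sum.
  by rewrite big_seq1 innerL2_fourier_coeff // inE eq_sym (negPf ij) mulr0.
- move=> f Hf; exists (fun i x => innerL2 mu f (e i) * e i x).
    move=> i; split; first exact: sq_integrableZ.
    by exists (innerL2 mu f (e i)); apply/aeW.
  move=> eps eps0; have [F0 [c fc]] := complete f Hf eps eps0.
  exists F0 => F F0F; apply: le_lt_trans fc.
  (* Padding the coefficients by zero turns the approximation over [F0] into one over the larger
     [F], where the Fourier sum does at least as well. This gives convergence along the whole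
     net. *)
  have -> : (fun x => f x - \sum_(i <- F0) c i * e i x) =
      (fun x => f x - \sum_(i <- F) (if i \in F0 then c i else 0) * e i x).
    apply/funext => x; congr (_ - _).
    rewrite -(big_fset_incl _ F0F) => [|i _ /negPf ->]; last by rewrite mul0r.
    by rewrite big_seq [RHS]big_seq; apply: eq_bigr => i ->.
  exact: normL2_best_approx.
Qed.

End OrthonormalBasis.

(** * Characters of the torus *)

Section UnitCircle.
Context {R : realType}.
Implicit Types s t : R.

Definition e2pi (t : R) : R[i] := cos (t * (pi *+ 2)) +i* sin (t * (pi *+ 2)).

Lemma e2piD s t : e2pi (s + t) = e2pi s * e2pi t.
Proof. by rewrite /e2pi mulrDl cosD sinD; simpc; congr (_ +i* _); ring. Qed.

Lemma e2piN t : e2pi (- t) = (e2pi t)^*%C.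
Proof. by rewrite /e2pi mulNr cosN sinN. Qed.

Lemma e2pi0 : e2pi 0 = 1.
Proof. by rewrite /e2pi mul0r cos0 sin0. Qed.

Lemma e2pi_half : e2pi 2^-1 = -1.
Proof.
rewrite /e2pi (_ : 2^-1 * (pi *+ 2) = pi); last by rewrite -mulr_natl; field.
by rewrite cospi sinpi; simpc.
Qed.

Lemma e2pi_int (k : int) : e2pi (k%:~R : R) = 1.
Proof.
have nat1 (j : nat) : e2pi (j%:R : R) = 1.
  elim: j => [|j IH]; first exact: e2pi0.
  by rewrite -natr1 e2piD IH mul1r /e2pi mul1r cos2pi sin2pi.
case: (intP k) => [|j|j]; first exact: e2pi0.
  by rewrite -pmulrn nat1.
by rewrite mulrNz e2piN -pmulrn nat1 conjc1.
Qed.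

Lemma ltr_cos2pi (t r : R) : 0 <= t <= 2^-1 -> 0 <= r <= 2^-1 ->
  (cos (t * (pi *+ 2)) < cos (r * (pi *+ 2))) = (r < t).
Proof.
have pi0 := pi_gt0 R.
have itv (s : R) : 0 <= s <= 2^-1 -> s * (pi *+ 2) \in `[0, pi].
  move=> /andP[s0 s1]; rewrite in_itv /= -mulr_natl; apply/andP; split; nra.
move=> /itv t1 /itv r1; rewrite ltr_cos // ltr_pM2r //.
by rewrite mulrn_wgt0.
Qed.

Lemma e2pi_near_int (t r : R) : 0 <= r <= 2^-1 ->
  cos (r * (pi *+ 2)) < complex.Re (e2pi t) ->
  exists k : int, `|t - k%:~R| < r.
Proof.
(* This floor is an integer nearest to $t$. The distance to it is at most $1/2$, the range on which
   $s\mapsto\cos(2\pi s)$ is strictly decreasing. *)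
move=> r2; set k := Num.floor (t + 2^-1).
have /andP[k1 k2] := floor_itv (t + 2^-1).
rewrite -/k in k1 k2.
have u2 : 0 <= `|t - k%:~R| <= 2^-1.
  rewrite normr_ge0 /= ler_norml; rewrite intrD in k2; apply/andP; split; lra.
have -> : e2pi t = e2pi (t - k%:~R).
  by rewrite e2piD -mulrNz e2pi_int mulr1.
rewrite /= => H; exists k; rewrite -ltr_cos2pi //.
have [_|_] := ger0P (t - k%:~R); first by [].
by rewrite mulNr cosN.
Qed.

End UnitCircle.

Section Characters.
Context {R : realType} {m n : nat} (Omega : 'M[R[i]]_n).
Hypothesis HOmega : siegel R n Omega.
Implicit Types (A B : 'M[int]_(m, n)) (Z W : 'M[R[i]]_(m, n)) (a b : 'M[R]_(m, n)).

Lemma expoE A B Z : expo Omega A B Z = e2pi (expo_phase Omega A B Z).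
Proof.
rewrite /expo; move: (expo_phase _ _ _ _) => y.
have -> : 2%:R * pi%:C * 'i%C * y%:C = 0 +i* (y * (pi *+ 2)) :> R[i].
  rewrite -(rmorph_nat (real_complex R)) /=; simpc; congr (_ +i* _); ring.
by rewrite /cexp /= expR0 mul1r.
Qed.

Lemma expo_phaseDz A B Z W :
  expo_phase Omega A B (Z + W) = expo_phase Omega A B Z + expo_phase Omega A B W.
Proof.
rewrite /expo_phase.
have -> : Re_mx (Z + W) = Re_mx Z + Re_mx W.
  by apply/matrixP => i j; rewrite !mxE ReD.
have -> : Im_mx (Z + W) = Im_mx Z + Im_mx W.
  by apply/matrixP => i j; rewrite !mxE ImD.
by rewrite !(mulmxDr, linearD) /= addrACA.
Qed.

Lemma expo_phaseZz A B Z (t : R) :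
  expo_phase Omega A B (t%:C *: Z) = t * expo_phase Omega A B Z.
Proof.
rewrite /expo_phase.
have -> : Re_mx (t%:C *: Z) = t *: Re_mx Z.
  by apply/matrixP => i j; rewrite !mxE; case: (Z i j) => ? ? /=; rewrite mul0r subr0.
have -> : Im_mx (t%:C *: Z) = t *: Im_mx Z.
  by apply/matrixP => i j; rewrite !mxE; case: (Z i j) => ? ? /=; rewrite mul0r addr0.
by rewrite -scalemxAr [(_ *: _)^T]linearZ /= -scalemxAr !mxtraceZ mulrDr.
Qed.

Lemma expo_phaseD A B A' B' Z :
  expo_phase Omega (A + A') (B + B') Z =
  expo_phase Omega A B Z + expo_phase Omega A' B' Z.
Proof.
rewrite /expo_phase !map_mxD raddfD /= (mulmxDl (map_mx intr A)) opprD.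
by rewrite (addrACA (map_mx intr B)) !mulmxDl !mxtraceD addrACA.
Qed.

Lemma expo_phase0 Z : expo_phase Omega (0 : 'M[int]_(m, n)) 0 Z = 0.
Proof.
by rewrite /expo_phase !raddf0 !mul0mx subr0 !mul0mx !raddf0 addr0.
Qed.

Lemma expo_phaseN A B Z :
  expo_phase Omega (- A) (- B) Z = - expo_phase Omega A B Z.
Proof.
by apply/eqP; rewrite -addr_eq0 -expo_phaseD !addNr expo_phase0.
Qed.

(* The point with real coordinates [a] and [b] in a basis of the lattice. *)
Definition period_point a b : 'M[R[i]]_(m, n) :=
  map_mx (real_complex R) a + map_mx (real_complex R) b *m Omega.

Lemma Re_period_point a b : Re_mx (period_point a b) = a + b *m Re_mx Omega.
Proof.
apply/matrixP => k l; rewrite !mxE ReD /=; congr (_ + _).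
rewrite (big_morph _ (@ReD R) (erefl : complex.Re 0 = 0)); apply: eq_bigr => j _.
by rewrite !mxE; case: (Omega j l) => ? ? /=; rewrite mul0r subr0.
Qed.

Lemma Im_period_point a b : Im_mx (period_point a b) = b *m Im_mx Omega.
Proof.
apply/matrixP => k l; rewrite !mxE ImD /= add0r.
rewrite (big_morph _ (@ImD R) (erefl : complex.Im 0 = 0)); apply: eq_bigr => j _.
by rewrite !mxE; case: (Omega j l) => ? ? /=; rewrite mul0r addr0.
Qed.

Let Im_unit : Im_mx Omega \in unitmx.
Proof. by case: HOmega => _; exact: posdefmx_unit. Qed.

(** Solving $V=bY$ and $U=a+bX$ gives $b=VY^{-1}$ and $a=U-VY^{-1}X$. *)
Lemma period_point_surj Z : exists a b, Z = period_point a b.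
Proof.
exists (Re_mx Z - Im_mx Z *m invmx (Im_mx Omega) *m Re_mx Omega),
  (Im_mx Z *m invmx (Im_mx Omega)).
set W := period_point _ _.
have RE : Re_mx Z = Re_mx W by rewrite Re_period_point subrK.
have IE : Im_mx Z = Im_mx W by rewrite Im_period_point mulmxKV.
clearbody W; apply/matrixP => k l; move/matrixP/(_ k l): RE; move/matrixP/(_ k l): IE.
by rewrite !mxE => IE RE; apply/eqP; rewrite eq_complex IE RE !eqxx.
Qed.

(** Substituting $U=a+bX$ and $V=bY$, the term $\sigma({}^tA\,bX)$ cancels $-\sigma(AX\,{}^tb)$ by
    symmetry of $X$. The odd-looking $B-AX$ in the exponent is there for this cancellation. *)
Lemma expo_phase_period_point A B a b :
  expo_phase Omega A B (period_point a b) =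
  \tr ((map_mx intr A)^T *m a) + \tr (map_mx intr B *m b^T).
Proof.
rewrite /expo_phase Re_period_point Im_period_point.
case: HOmega => OmegaT _.
have XT : (Re_mx Omega)^T = Re_mx Omega by rewrite /Re_mx map_trmx OmegaT.
have YT : (Im_mx Omega)^T = Im_mx Omega by rewrite /Im_mx map_trmx OmegaT.
have trB p (M N : 'M[R]_p) : \tr (M - N) = \tr M - \tr N by rewrite linearB.
rewrite mulmxDr mxtraceD trmx_mul YT (mulmxA _ (Im_mx Omega)) mulmxKV // mulmxBl trB.
have -> : \tr ((map_mx intr A)^T *m (b *m Re_mx Omega)) =
    \tr (map_mx intr A *m Re_mx Omega *m b^T).
  rewrite -mxtrace_tr !trmx_mul trmxK XT -mulmxA mxtrace_mulC.
  by rewrite -mulmxA mxtrace_mulC.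
by ring.
Qed.

Lemma mxtrace_delta_l (k : 'I_m) (l : 'I_n) (a : 'M[R]_(m, n)) :
  \tr ((delta_mx k l)^T *m a) = a k l.
Proof.
rewrite trmx_delta /mxtrace (bigD1 l) //= big1 ?addr0 => [|j jl].
  rewrite mxE (bigD1 k) //= big1 ?addr0 => [|i ik].
    by rewrite mxE !eqxx mul1r.
  by rewrite mxE (negPf ik) andbF mul0r.
by rewrite mxE big1 // => i _; rewrite mxE (negPf jl) mul0r.
Qed.

Lemma expo_phase_l (k : 'I_m) (l : 'I_n) a b :
  expo_phase Omega (delta_mx k l) 0 (period_point a b) = a k l.
Proof.
rewrite expo_phase_period_point map_delta_mx !raddf0 mul0mx raddf0 addr0.
exact: mxtrace_delta_l.
Qed.

Lemma expo_phase_r (k : 'I_m) (l : 'I_n) a b :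
  expo_phase Omega 0 (delta_mx k l) (period_point a b) = b k l.
Proof.
rewrite expo_phase_period_point map_delta_mx !raddf0 mul0mx raddf0 add0r.
by rewrite -mxtrace_tr trmx_mul trmxK mxtrace_mulC mxtrace_delta_l.
Qed.

Lemma expo_nontrivial A B : (A, B) != 0 ->
  exists Z, expo Omega A B Z = -1.
Proof.
move=> AB0; suff [a [b E]] : exists a b,
    expo_phase Omega A B (period_point a b) = 2^-1.
  by exists (period_point a b); rewrite expoE E e2pi_half.
have nz (C : 'M[int]_(m, n)) : C != 0 -> exists k l, (C k l)%:~R != 0 :> R.
  move=> C0; apply: contrapT => H; case/eqP: C0; apply/matrixP => k l.
  rewrite mxE; apply/eqP; rewrite -(intr_eq0 R); apply: contrapT => /negP kl.
  by apply: H; exists k, l.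
have [A0|/nz[k [l kl]]] := eqVneq A 0; last first.
  (* Moving the single coordinate $(k,l)$ by $1/(2A_{kl})$ makes the phase exactly $1/2$. *)
  exists ((2 * (A k l)%:~R)^-1 *: delta_mx k l), 0.
  rewrite expo_phase_period_point trmx0 mulmx0 raddf0 addr0 -scalemxAr mxtraceZ.
  rewrite -[\tr _]mxtrace_tr trmx_mul trmxK mxtrace_delta_l mxE.
  by rewrite invfM mulfVK.
have /nz[k [l kl]] : B != 0 by apply: contraNneq AB0 => B0; rewrite A0 B0.
exists 0, ((2 * (B k l)%:~R)^-1 *: delta_mx k l).
rewrite expo_phase_period_point mulmx0 raddf0 add0r linearZ /= -scalemxAr mxtraceZ.
rewrite mxtrace_mulC mxtrace_delta_l mxE.
by rewrite invfM mulfVK.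
Qed.

End Characters.

(** * Continuity on complex matrices through real and imaginary parts *)

Section ComplexTopology.
Context {R : realType}.

(** Balls of [R[i]] have their radii in [R[i]] itself; a positive complex number is real, so real
    radii suffice. *)
Lemma nbhs_complexP (z : R[i]) (P : set R[i]) : nbhs z P <->
  exists2 e : R, 0 < e & forall w, `|z - w| < e%:C -> P w.
Proof.
split=> [/nbhs_ballP[e e0 eP]|[e e0 eP]]; last first.
  by apply/nbhs_ballP; exists e%:C => [|w zw]; [rewrite /= ltcR|exact: eP].
have [eR Re0] : e = (complex.Re e)%:C /\ 0 < complex.Re e.
  by move: e0; rewrite /= ltcE /=; case: e {eP} => a b /= /andP[/eqP -> ].
by exists (complex.Re e) => // w zw; apply: eP; rewrite /ball /= eR.
Qed.

Lemma Re_Im_le_norm (z : R[i]) (e : R) : `|z| < e%:C ->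
  `|complex.Re z| < e /\ `|complex.Im z| < e.
Proof.
rewrite normc_def ltcR => ze; split; apply: le_lt_trans ze;
  rewrite -sqrtr_sqr ler_wsqrtr //.
- by rewrite lerDl sqr_ge0.
- by rewrite lerDr sqr_ge0.
Qed.

Lemma continuous_Re : continuous (@complex.Re R : R[i] -> R).
Proof.
move=> z A /nbhs_ballP[e /= e0 eA]; apply/nbhs_complexP; exists e => // w zw.
by apply: eA; rewrite /ball /= -raddfB; have [] := Re_Im_le_norm zw.
Qed.

Lemma continuous_Im : continuous (@complex.Im R : R[i] -> R).
Proof.
move=> z A /nbhs_ballP[e /= e0 eA]; apply/nbhs_complexP; exists e => // w zw.
by apply: eA; rewrite /ball /= -raddfB; have [] := Re_Im_le_norm zw.
Qed.

Lemma continuous_Re_comp (X : topologicalType) (f : X -> R[i]) :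
  continuous f -> continuous (fun x => complex.Re (f x)).
Proof. by move=> cf x; apply: cvg_comp; [exact: cf|exact: continuous_Re]. Qed.

Lemma continuous_Im_comp (X : topologicalType) (f : X -> R[i]) :
  continuous f -> continuous (fun x => complex.Im (f x)).
Proof. by move=> cf x; apply: cvg_comp; [exact: cf|exact: continuous_Im]. Qed.

Lemma continuous_complex (X : topologicalType) (f g : X -> R) :
  continuous f -> continuous g -> continuous (fun x => f x +i* g x : R[i]).
Proof.
move=> cf cg x A /nbhs_complexP[e e0 eA].
have e2 : 0 < e / 2 by rewrite divr_gt0.
have nf : \forall y \near x, `|f x - f y| < e / 2.
  by have /cvgrPdist_lt/(_ _ e2) := cf x.
have ng : \forall y \near x, `|g x - g y| < e / 2.
  by have /cvgrPdist_lt/(_ _ e2) := cg x.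
apply: filterS2 nf ng => y fy gy; apply: eA.
rewrite normc_def ltcR /= -[X in _ < X]ger0_norm ?(ltW e0) // -sqrtr_sqr.
rewrite ltr_sqrt ?exprn_gt0 //.
rewrite -(real_normK (num_real (f x - f y))) -(real_normK (num_real (g x - g y))).
have := normr_ge0 (f x - f y); have := normr_ge0 (g x - g y); nra.
Qed.

Lemma continuous_mx (X : topologicalType) (m n : nat) (S : topologicalType)
    (f : X -> 'M[S]_(m, n)) :
  (forall i j, continuous (fun x => f x i j)) -> continuous f.
Proof.
move=> cf x A [P Px PA].
have H : \forall y \near x, forall ij : 'I_m * 'I_n, P ij.1 ij.2 (f y ij.1 ij.2).
  by apply: filter_forall => -[i j] /=; apply: cf; exact: Px.
by apply: filterS H => y Hy; apply: PA => i j; exact: (Hy (i, j)).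
Qed.

Lemma continuous_coord (m n : nat) (S : topologicalType) (i : 'I_m) (j : 'I_n) :
  continuous (fun M : 'M[S]_(m, n) => M i j).
Proof.
move=> M A MA; exists (fun k l => if (k == i) && (l == j) then A else setT).
  move=> k l; case: ifPn => [/andP[/eqP -> /eqP ->] //|_]; exact: filterT.
by move=> N /(_ i j); rewrite !eqxx.
Qed.

Lemma continuous_addr (X : topologicalType) (f g : X -> R) :
  continuous f -> continuous g -> continuous (fun x => f x + g x).
Proof. by move=> cf cg x; apply: cvgD; [exact: cf|exact: cg]. Qed.

Lemma continuous_mulr (X : topologicalType) (f g : X -> R) :
  continuous f -> continuous g -> continuous (fun x => f x * g x).
Proof. by move=> cf cg x; apply: cvgM; [exact: cf|exact: cg]. Qed.

Lemma continuous_cstr (X : topologicalType) (c : R) : continuous (fun _ : X => c).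
Proof. by move=> x; exact: cvg_cst. Qed.

Lemma continuous_sum (X : topologicalType) (I : Type) (s : seq I) (f : I -> X -> R) :
  (forall i, continuous (f i)) -> continuous (fun x => \sum_(i <- s) f i x).
Proof.
move=> cf; elim: s => [|i s IH] x.
  by under eq_fun do rewrite big_nil; exact: cvg_cst.
under eq_fun do rewrite big_cons.
by apply: cvgD; [exact: cf|exact: IH].
Qed.

Lemma continuous_coord_Re (m n : nat) (i : 'I_m) (j : 'I_n) :
  continuous (fun Z : 'M[R[i]]_(m, n) => complex.Re (Z i j)).
Proof. by apply: continuous_Re_comp; exact: continuous_coord. Qed.

Lemma continuous_coord_Im (m n : nat) (i : 'I_m) (j : 'I_n) :
  continuous (fun Z : 'M[R[i]]_(m, n) => complex.Im (Z i j)).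
Proof. by apply: continuous_Im_comp; exact: continuous_coord. Qed.

Lemma continuous_addl_mx (m n : nat) (W : 'M[R[i]]_(m, n)) :
  continuous (fun Z : 'M[R[i]]_(m, n) => W + Z).
Proof.
apply: continuous_mx => i j.
have -> : (fun Z => (W + Z) i j) =
    (fun Z => (complex.Re (W i j) + complex.Re (Z i j)) +i*
              (complex.Im (W i j) + complex.Im (Z i j))).
  by apply/funext => Z; rewrite mxE; case: (W i j) (Z i j) => [? ?] [? ?].
apply: continuous_complex; apply: continuous_addr; try exact: continuous_cstr.
  exact: continuous_coord_Re.
exact: continuous_coord_Im.
Qed.

Lemma continuous_expo_phase (m n : nat) (Omega : 'M[R[i]]_n) (A B : 'M[int]_(m, n)) :
  continuous (expo_phase Omega A B).
Proof.
have ctr p q (C : 'M[R]_(p, q)) (f : 'M[R[i]]_(m, n) -> 'M[R]_(q, p)) :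
    (forall i j, continuous (fun Z => f Z i j)) ->
    continuous (fun Z => \tr (C *m f Z)).
  move=> cf; apply: continuous_sum => i.
  under eq_fun do rewrite mxE; apply: continuous_sum => j.
  by apply: continuous_mulr; [exact: continuous_cstr|exact: cf].
apply: continuous_addr.
  apply: (ctr _ _ _ (fun Z => Re_mx Z)) => i j.
  by under eq_fun do rewrite mxE; exact: continuous_coord_Re.
apply: (ctr _ _ _ (fun Z => (Im_mx Z)^T)) => i j.
by under eq_fun do rewrite !mxE; exact: continuous_coord_Im.
Qed.

Lemma continuous_expo (m n : nat) (Omega : 'M[R[i]]_n) (A B : 'M[int]_(m, n)) :
  continuous (expo Omega A B).
Proof.
have -> : expo Omega A B = (fun Z => e2pi (expo_phase Omega A B Z)).
  by apply/funext => Z; rewrite expoE.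
have cp : continuous (fun Z => expo_phase Omega A B Z * (pi *+ 2)).
  by apply: continuous_mulr; [exact: continuous_expo_phase|exact: continuous_cstr].
by apply: continuous_complex => Z;
  [apply: (cvg_comp _ _ (cp Z)); exact: continuous_cos
  |apply: (cvg_comp _ _ (cp Z)); exact: continuous_sin].
Qed.

Lemma continuous_scale_expo (m n : nat) (Omega : 'M[R[i]]_n) (A B : 'M[int]_(m, n))
    (c : R[i]) : continuous (fun Z => c * expo Omega A B Z).
Proof.
have cR := continuous_Re_comp (@continuous_expo _ _ Omega A B).
have cI := continuous_Im_comp (@continuous_expo _ _ Omega A B).
have -> : (fun Z => c * expo Omega A B Z) = (fun Z =>
    (complex.Re c * complex.Re (expo Omega A B Z) +
      - complex.Im c * complex.Im (expo Omega A B Z)) +i*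
    (complex.Re c * complex.Im (expo Omega A B Z) +
      complex.Im c * complex.Re (expo Omega A B Z))).
  apply/funext => Z; case: c (expo _ _ _ _) => u v [w z] /=.
  by simpc; congr (_ +i* _); ring.
by apply: continuous_complex; apply: continuous_addr; apply: continuous_mulr => //;
  exact: continuous_cstr.
Qed.

Lemma continuous_period_point (m n : nat) (Omega : 'M[R[i]]_n) :
  continuous (fun ab : 'M[R]_(m, n) * 'M[R]_(m, n) =>
    period_point Omega ab.1 ab.2).
Proof.
have cf i j : continuous (fun ab : 'M[R]_(m, n) * 'M[R]_(m, n) => ab.1 i j).
  move=> ab; apply: (@continuous_comp _ _ _ fst (fun a : 'M[R]_(m, n) => a i j)).
    exact: cvg_fst.
  exact: continuous_coord.
have cs i j : continuous (fun ab : 'M[R]_(m, n) * 'M[R]_(m, n) => ab.2 i j).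
  move=> ab; apply: (@continuous_comp _ _ _ snd (fun a : 'M[R]_(m, n) => a i j)).
    exact: cvg_snd.
  exact: continuous_coord.
have cM i j (C : 'M[R]_n) :
    continuous (fun ab : 'M[R]_(m, n) * 'M[R]_(m, n) => (ab.2 *m C) i j).
  under eq_fun do rewrite mxE; apply: continuous_sum => k.
  by apply: continuous_mulr; [exact: cs|exact: continuous_cstr].
apply: continuous_mx => i j.
have -> : (fun ab : 'M[R]_(m, n) * 'M[R]_(m, n) => period_point Omega ab.1 ab.2 i j) =
    (fun ab => (ab.1 i j + (ab.2 *m Re_mx Omega) i j) +i*
       (ab.2 *m Im_mx Omega) i j).
  apply/funext => ab; set Z := period_point _ _ _.
  have -> : (ab.2 *m Im_mx Omega) i j = Im_mx Z i j by rewrite Im_period_point.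
  have -> : ab.1 i j + (ab.2 *m Re_mx Omega) i j = Re_mx Z i j.
    by rewrite Re_period_point [RHS]mxE.
  by clearbody Z; rewrite !mxE; case: (Z i j).
apply: continuous_complex; last exact: cM.
by apply: continuous_addr; [exact: cf|exact: cM].
Qed.

End ComplexTopology.

(** * Borel structure of the torus and integrals of characters *)

Section TorusMeasure.
Context {R : realType} {m n : nat} {Omega : 'M[R[i]]_n}.
Hypothesis HOmega : siegel R n Omega.
Local Notation T := (torus m Omega).
Local Notation piT := (\pi_(torus m Omega)%qT).
Implicit Types A B : 'M[int]_(m, n).

(** A set is open in the quotient when its preimage under the projection is, so the preimage of an
    open ray under [f] is open, hence Borel. *)
Lemma measurable_torus_lift (f : T -> R) :
  continuous (fun Z => f (piT Z)) -> measurable_fun setT f.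
Proof.
move=> cf; apply: (measurability _ (RGenOInfty.measurableE R)) => //.
move=> /= _ [_ [x ->] <-]; rewrite setTI; apply: sub_sigma_algebra.
have /continuousP/(_ `]x, +oo[%classic) := cf.
by apply; exact: interval_open.
Qed.

Lemma measurable_translation (a : T) : measurable_fun setT (fun x : T => a + x).
Proof.
apply: (measurability _ (erefl : @measurable _ T = <<s @open T >>)).
move=> /= _ [U oU <-]; rewrite setTI; apply: sub_sigma_algebra.
change (open (piT @^-1` ((fun x : T => a + x) @^-1` U))).
have -> : piT @^-1` ((fun x : T => a + x) @^-1` U) =
    (fun Z => repr a + Z) @^-1` (piT @^-1` U).
  by apply/funext => Z /=; rewrite raddfD /= reprK.
have /continuousP/(_ (piT @^-1` U)) := @continuous_addl_mx R m n (repr a).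
exact.
Qed.

Lemma torus_expoD A B (x y : T) :
  torus_expo Omega A B (x + y) = torus_expo Omega A B x * torus_expo Omega A B y.
Proof.
rewrite -[x in LHS]reprK -[y in LHS]reprK.
rewrite (_ : piT _ + piT _ = piT (repr x + repr y)); last by rewrite raddfD.
by rewrite torus_expoE // /torus_expo !expoE expo_phaseDz e2piD.
Qed.

Lemma torus_expo_mul A B A' B' (x : T) :
  torus_expo Omega (A + A') (B + B') x =
  torus_expo Omega A B x * torus_expo Omega A' B' x.
Proof. by rewrite /torus_expo !expoE expo_phaseD e2piD. Qed.

Lemma torus_expo_conj A B (x : T) :
  torus_expo Omega (- A) (- B) x = (torus_expo Omega A B x)^*%C.
Proof. by rewrite /torus_expo !expoE expo_phaseN e2piN. Qed.

Lemma torus_expo0 (x : T) : torus_expo Omega (0 : 'M[int]_(m, n)) 0 x = 1.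
Proof. by rewrite /torus_expo expoE expo_phase0 e2pi0. Qed.

Lemma torus_expo_neq0 A B (x : T) : torus_expo Omega A B x != 0.
Proof.
have := oner_neq0 R[i]; apply: contraNneq => Ex0.
by have := torus_expo_mul A B (- A) (- B) x; rewrite !addrN torus_expo0 Ex0 mul0r => ->.
Qed.

Lemma measurable_Re_torus_expo A B :
  measurable_fun setT (fun x : T => complex.Re (torus_expo Omega A B x)).
Proof.
apply: measurable_torus_lift; under eq_fun do rewrite torus_expoE //.
by apply: continuous_Re_comp; exact: continuous_expo.
Qed.

Lemma measurable_Im_torus_expo A B :
  measurable_fun setT (fun x : T => complex.Im (torus_expo Omega A B x)).
Proof.
apply: measurable_torus_lift; under eq_fun do rewrite torus_expoE //.
by apply: continuous_Im_comp; exact: continuous_expo.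
Qed.

Lemma Re_torus_expo_bounded A B (x : T) :
  `|complex.Re (torus_expo Omega A B x)| <= 1.
Proof. by rewrite /torus_expo expoE /= ler_norml cos_geN1 cos_le1. Qed.

Lemma Im_torus_expo_bounded A B (x : T) :
  `|complex.Im (torus_expo Omega A B x)| <= 1.
Proof. by rewrite /torus_expo expoE /= ler_norml sin_geN1 sin_le1. Qed.

Variable vol : probability T R.
Hypothesis vol_invariant : translation_invariant vol.

(** Invariance says that [vol] is its own pushforward under the translation, so this is a change of
    variables. *)
Lemma Rintegral_translation (a : T) (f : T -> R) : measurable_fun setT f ->
  vol.-integrable setT (EFin \o (fun x => f (a + x))) ->
  \int[vol]_x f (a + x) = \int[vol]_x f x.
Proof.
move=> mf intf.
have mphi := measurable_translation a.
pose phi : {mfun T >-> T} := HB.pack (fun x : T => a + x)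
  (isMeasurableFun.Build _ _ _ _ _ mphi).
rewrite /Rintegral; congr fine.
have mEf : measurable_fun setT (EFin \o f) by exact/measurable_EFinP.
rewrite -[LHS](integral_pushforward mphi (D := setT) mEf) //.
apply: (@eq_measure_integral _ _ _ _ vol (pushforward vol phi)) => S mS _.
have mS' : measurable ((fun x : T => a + x) @^-1` S).
  by have := mphi measurableT S mS; rewrite setTI.
change (vol ((fun x : T => a + x) @^-1` S) = vol S).
(* Invariance speaks of images: it is applied to the preimage of [S], whose image under the
   translation is [S]. *)
rewrite -(vol_invariant a mS').
congr (vol _); apply/seteqP; split=> [_ [x xS <-] //|x Sx].
by exists (x - a); rewrite /= addrC subrK.
Qed.

Lemma bounded_integrable (f : T -> R) (M : R) : measurable_fun setT f ->
  (forall x, `|f x| <= M) -> vol.-integrable setT (EFin \o f).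
Proof.
move=> mf fM; apply: (@le_integrable _ _ _ _ _ measurableT _ (EFin \o (fun=> M))).
- exact/measurable_EFinP.
- by move=> x _ /=; rewrite lee_fin (le_trans (fM x)) // ler_norm.
- exact: finite_measure_integrable_cst.
Qed.

Lemma cintegrable_torus_expo A B : cintegrable vol (torus_expo Omega A B).
Proof.
split; apply: (@bounded_integrable _ 1).
- exact: measurable_Re_torus_expo.
- exact: Re_torus_expo_bounded.
- exact: measurable_Im_torus_expo.
- exact: Im_torus_expo_bounded.
Qed.

Lemma sq_integrable_torus_expo A B : sq_integrable vol (torus_expo Omega A B).
Proof.
split; [exact: measurable_Re_torus_expo|exact: measurable_Im_torus_expo|].
have -> : (fun x => (complex.Re (torus_expo Omega A B x) ^+ 2 +
    complex.Im (torus_expo Omega A B x) ^+ 2)%:E) = cst 1%E :> (T -> \bar R).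
  by apply/funext => x; rewrite /torus_expo expoE /= cos2Dsin2.
rewrite integral_cst // mul1e; apply: le_lt_trans (probability_le1 _ _) _ => //.
exact: ltry.
Qed.

Lemma cintegral_torus_expo A B :
  cintegral vol (torus_expo Omega A B) = ((A, B) == 0)%:R.
Proof.
have [AB0|AB0] := eqVneq (A, B) 0.
  case: AB0 => -> ->; rewrite (_ : torus_expo _ _ _ = fun=> 1); last first.
    by apply/funext => x; rewrite torus_expo0.
  rewrite /cintegral /= !Rintegral_cst //.
  rewrite ![X in fine X](_ : _ = 1%E); try exact: probability_setT.
  by rewrite mul0r mul1r.
have [W EW] := expo_nontrivial HOmega AB0.
set E := torus_expo Omega A B.
have EN x : E (piT W + x) = - E x.
  by rewrite /E torus_expoD torus_expoE // EW mulN1r.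
have inv : cintegral vol (fun x => E (piT W + x)) = cintegral vol E.
  have [ER EI] := cintegrable_torus_expo A B.
  congr (_ +i* _).
  - apply: (Rintegral_translation (f := fun x => complex.Re (E x))).
      exact: measurable_Re_torus_expo.
    rewrite (_ : (fun x => _) = (fun x => -1 * complex.Re (E x))).
      by apply: (integrableZl measurableT (-1) ER).
    apply/funext => x; rewrite mulN1r -raddfN; congr complex.Re; exact: EN.
  - apply: (Rintegral_translation (f := fun x => complex.Im (E x))).
      exact: measurable_Im_torus_expo.
    rewrite (_ : (fun x => _) = (fun x => -1 * complex.Im (E x))).
      by apply: (integrableZl measurableT (-1) EI).
    apply/funext => x; rewrite mulN1r -raddfN; congr complex.Im; exact: EN.
have : - cintegral vol E = cintegral vol E.
  rewrite -[RHS]inv -mulN1r -cintegralZ; last exact: cintegrable_torus_expo.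
  by congr cintegral; apply/funext => x; rewrite mulN1r EN.
by move/eqP; rewrite eqNr => /eqP.
Qed.

(** Since $E_i\overline{E_j}=E_{i-j}$, every inner product is the integral of a single character. *)
Lemma torus_expo_orthonormal (AB AB' : 'M[int]_(m, n) * 'M[int]_(m, n)) :
  innerL2 vol (torus_expo Omega AB.1 AB.2) (torus_expo Omega AB'.1 AB'.2) =
  (AB == AB')%:R.
Proof.
rewrite /innerL2 -subr_eq0 -cintegral_torus_expo; congr cintegral.
by apply/funext => x; rewrite -torus_expo_conj -torus_expo_mul.
Qed.

End TorusMeasure.

(** * Completeness of the characters *)

Section Completeness.
Context {R : realType} {m n : nat} {Omega : 'M[R[i]]_n}.
Hypothesis HOmega : siegel R n Omega.
Local Notation T := (torus m Omega).
Local Notation piT := (\pi_(torus m Omega)%qT).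
Local Notation IM := ('M[int]_(m, n) * 'M[int]_(m, n))%type.
Local Notation E := (fun i : IM => torus_expo Omega i.1 i.2).
Variable vol : probability T R.

(** Terms form a list in which indices may repeat, so that sums are concatenations and products are
    lists of all pairs; like terms are collected only in [trig_sum_fset]. *)
Definition trig_sum (s : seq (R[i] * IM)) (x : T) : R[i] :=
  \sum_(j <- s) j.1 * E j.2 x.

Definition real_trig_poly : set (T -> R) :=
  [set p | exists s, forall x, (p x)%:C = trig_sum s x].

Lemma trig_sum_bounded s : exists M : R, forall x,
  `|complex.Re (trig_sum s x)| <= M.
Proof.
elim: s => [|[c i] s [M IH]].
  by exists 0 => x; rewrite /trig_sum big_nil normr0.
exists (`|complex.Re c| + `|complex.Im c| + M) => x.
rewrite /trig_sum big_cons ReD (le_trans (ler_normD _ _)) // lerD ?IH //=.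
rewrite ReM (le_trans (ler_normB _ _)) // !normrM lerD //.
  by rewrite ler_piMr // Re_torus_expo_bounded.
by rewrite ler_piMr // Im_torus_expo_bounded.
Qed.

Lemma trig_sumM s s' x : trig_sum s x * trig_sum s' x =
  trig_sum [seq (j.1 * k.1, j.2 + k.2) | j <- s, k <- s'] x.
Proof.
rewrite /trig_sum big_allpairs_dep /= mulr_suml; apply: eq_bigr => j _.
rewrite mulr_sumr; apply: eq_bigr => k _.
by rewrite torus_expo_mul mulrACA.
Qed.

Lemma trig_sum_measurable s :
  measurable_fun setT (fun x => complex.Re (trig_sum s x)).
Proof.
have [] // : sq_integrable vol (trig_sum s).
by apply: (sq_integrable_sum s (fun j => j.1) (e := fun j => E j.2)) => j;
  exact: sq_integrable_torus_expo.
Qed.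

Lemma real_trig_poly_cst (c : R) : real_trig_poly (fun=> c).
Proof.
by exists [:: (c%:C, (0, 0))] => x; rewrite /trig_sum big_seq1 torus_expo0 mulr1.
Qed.

Lemma real_trig_polyD p q : real_trig_poly p -> real_trig_poly q ->
  real_trig_poly (fun x => p x + q x).
Proof.
move=> [s ps] [s' qs]; exists (s ++ s') => x.
by rewrite rmorphD /= ps qs /trig_sum big_cat.
Qed.

Lemma real_trig_polyM p q : real_trig_poly p -> real_trig_poly q ->
  real_trig_poly (fun x => p x * q x).
Proof.
move=> [s ps] [s' qs]; eexists => x.
by rewrite rmorphM /= ps qs trig_sumM.
Qed.

Lemma real_trig_poly_measurable p : real_trig_poly p -> measurable_fun setT p.
Proof.
move=> [s ps]; rewrite (_ : p = fun x => complex.Re (trig_sum s x)).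
  exact: trig_sum_measurable.
by apply/funext => x; rewrite -ps.
Qed.

Lemma real_trig_poly_bounded p : real_trig_poly p ->
  exists M : R, forall x, `|p x| <= M.
Proof.
move=> [s ps]; have [M sM] := trig_sum_bounded s; exists M => x.
by have := sM x; rewrite -ps.
Qed.

(** From $\mathrm{Re}\,w=(w+\overline w)/2$, the conjugate of a character being the character of
    opposite index. *)
Lemma real_trig_poly_Re (c : R[i]) A B :
  real_trig_poly (fun x => complex.Re (c * torus_expo Omega A B x)).
Proof.
exists [:: (c / 2%:R, (A, B)); (c^*%C / 2%:R, (- A, - B))] => x.
rewrite /trig_sum big_cons big_seq1 /= torus_expo_conj ReJ_add rmorphM /=.
by rewrite mulrDl !(mulrAC _ (2%:R^-1)).
Qed.

Local Notation Lsets := (L2_sets vol real_trig_poly).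

Lemma bounded_algebra_trig_poly : bounded_algebra real_trig_poly.
Proof.
split; [exact: real_trig_poly_cst|exact: real_trig_polyD|exact: real_trig_polyM|
  exact: real_trig_poly_measurable|exact: real_trig_poly_bounded].
Qed.

(* Where the character is close to [e2pi t]. *)
Definition arc A B (t c : R) : set T :=
  [set x | c < complex.Re (e2pi (- t) * torus_expo Omega A B x)].

Lemma L2_sets_arc A B t c : `|c| <= 1 -> Lsets (arc A B t c).
Proof.
move=> c1.
pose u x := complex.Re (e2pi (- t) * torus_expo Omega A B x).
have u1 x : `|u x| <= 1.
  by rewrite /u /torus_expo expoE -e2piD /= ler_norml cos_geN1 cos_le1.
(* The affine map $u\mapsto u/4+1/2-c/4$ moves the threshold $c$ to $1/2$ and, as $|u|,|c|\le 1$,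
   has values in $[0,1]$, the range required by the thresholding lemma. *)
have -> : arc A B t c = [set x | 2^-1 < 4^-1 * u x + (2^-1 - 4^-1 * c)].
  apply/funext => x; change ((c < u x) = (2^-1 < 4^-1 * u x + (2^-1 - 4^-1 * c)) :> Prop).
  by apply/propext; split => ?; lra.
apply: (L2_sets_gt_half bounded_algebra_trig_poly).
- apply: (L2_closure_sub _ bounded_algebra_trig_poly).
  apply: real_trig_polyD; last exact: real_trig_poly_cst.
  by apply: real_trig_polyM; [exact: real_trig_poly_cst|exact: real_trig_poly_Re].
- move=> x; have := u1 x; move: c1; rewrite !ler_norml => /andP[? ?] /andP[? ?].
  by apply/andP; split; lra.
Qed.

(** Each lattice coordinate lies, modulo 1, within $1/(N+2)$ of a grid point with denominator $N+2$.
    The shift by 2 keeps this radius at most $1/2$, where the cosine determines the distance to the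
    nearest integer. Grid and radii are indexed by a countable type. *)
Definition box (N : nat) (PQ : IM) : set T :=
  [set x | forall kl : 'I_m * 'I_n,
     arc (delta_mx kl.1 kl.2) 0 ((PQ.1 kl.1 kl.2)%:~R / N.+2%:R)
       (cos (N.+2%:R^-1 * (pi *+ 2))) x /\
     arc 0 (delta_mx kl.1 kl.2) ((PQ.2 kl.1 kl.2)%:~R / N.+2%:R)
       (cos (N.+2%:R^-1 * (pi *+ 2))) x].

Lemma L2_sets_forall (I : finType) (F : I -> set T) :
  (forall i, Lsets (F i)) -> Lsets [set x | forall i, F i x].
Proof.
move=> HF.
have H (s : seq I) : Lsets [set x | forall i, i \in s -> F i x].
  elim: s => [|i s IH].
    rewrite (_ : mkset _ = ~` set0).
      apply: (L2_setsC bounded_algebra_trig_poly).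
      exact: (L2_sets0 _ bounded_algebra_trig_poly).
    by apply/seteqP; split=> [x _ []|x _ i].
  rewrite (_ : mkset _ = F i `&` [set x | forall i, i \in s -> F i x]).
    exact: (L2_setsI bounded_algebra_trig_poly (HF i) IH).
  apply/seteqP; split=> x /=.
    move=> H; split; first by apply: H; rewrite mem_head.
    by move=> j js; apply: H; rewrite inE js orbT.
  by move=> [Fi H] j; rewrite inE => /predU1P[->//|/H].
rewrite (_ : mkset _ = [set x | forall i, i \in enum I -> F i x]); first exact: H.
apply/seteqP; split=> x /= Fx i; first by move=> _; exact: Fx.
by apply: Fx; rewrite mem_enum.
Qed.

Lemma L2_sets_box N PQ : Lsets (box N PQ).
Proof.
have c1 (t : R) : `|cos t| <= 1 by rewrite ler_norml cos_geN1 cos_le1.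
apply: L2_sets_forall => kl.
apply: (L2_setsI bounded_algebra_trig_poly);
  exact: L2_sets_arc.
Qed.

Lemma pi_period_point_int (a b : 'M[R]_(m, n)) (k l : 'M[int]_(m, n)) :
  piT (period_point Omega (a - map_mx intr k) (b - map_mx intr l)) =
  piT (period_point Omega a b).
Proof.
apply/eqP; rewrite -ring_quotient.Quotient.idealrBE; apply/asboolP.
exists (- k), (- l); rewrite /period_point !map_mxB mulmxBl.
have ii (M : 'M[int]_(m, n)) : map_mx (real_complex R) (map_mx intr M) = map_mx intr M.
  by apply/matrixP => i j; rewrite !mxE rmorph_int.
have iN (M : 'M[int]_(m, n)) : map_mx intr (- M) = - map_mx intr M :> 'M[R[i]]_(m, n).
  by rewrite raddfN.
rewrite !ii !iN mulNmx opprD addrACA.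
by rewrite [_ - _ - _]addrAC subrr add0r [X in _ + X]addrAC subrr add0r.
Qed.

Lemma box_refine (U : set T) x : open U -> U x ->
  exists N PQ, box N PQ x /\ box N PQ `<=` U.
Proof.
move=> oU Ux.
have [a [b xab]] := period_point_surj HOmega (repr x).
have xE : x = piT (period_point Omega a b) by rewrite -xab reprK.
have /continuousP/(_ (piT @^-1` U) oU) := @continuous_period_point R m n Omega.
rewrite openE => /(_ (a, b)) /=.
rewrite -xE => /(_ Ux) /nbhs_ballP[e /= e0 eU].
(* Two radii: the given point and any other point of the box are both close to the same grid point,
   so their coordinates differ by less than $2/(N+2)$ modulo integers. *)
have [N Ne] : exists N : nat, 2 / N.+2%:R < e.
  exists (Num.truncn (2 / e)); rewrite ltr_pdivrMr // mulrC -ltr_pdivrMr //.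
  by apply: lt_le_trans (truncnS_gt _) _; rewrite ler_nat.
have N0 : 0 < N.+2%:R :> R by [].
have N2 : 0 <= (N.+2%:R^-1 : R) <= 2^-1.
  by rewrite invr_ge0 ler0n /= lef_pV2 ?posrE // ler_nat.
(* Rounding down to the grid: the grid point found is at most the coordinate and less than $1/(N+2)$
   away from it. *)
pose fl (c : 'M[R]_(m, n)) : 'M[int]_(m, n) :=
  \matrix_(k, l) Num.floor (N.+2%:R * c k l).
have flP (c : 'M[R]_(m, n)) k l :
    0 <= c k l - (fl c k l)%:~R / N.+2%:R < N.+2%:R^-1.
  rewrite mxE; have /andP[] := floor_itv (N.+2%:R * c k l).
  set z := Num.floor _; rewrite intrD => z1 z2.
  rewrite subr_ge0 ltrBlDr ler_pdivrMr // [c k l * _]mulrC z1 /=.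
  by rewrite -(ltr_pM2l N0) mulrDr mulfV ?gt_eqF // mulrCA mulfV ?gt_eqF // mulr1 addrC.
exists N, (fl a, fl b); split.
  have arcP (c : 'M[R]_(m, n)) k l (A B : 'M[int]_(m, n)) :
      expo_phase Omega A B (period_point Omega a b) = c k l ->
      arc A B ((fl c k l)%:~R / N.+2%:R) (cos (N.+2%:R^-1 * (pi *+ 2))) x.
    move=> cE; rewrite /arc /mkset xE torus_expoE // expoE cE -e2piD [- _ + _]addrC.
    have /andP[f0 f1] := flP c k l; rewrite /e2pi /= ltr_cos2pi //.
    by case/andP: N2 => _ N2; rewrite f0 (le_trans (ltW f1)).
  by move=> [k l]; split; apply: arcP; rewrite ?expo_phase_l ?expo_phase_r.
move=> y; have [c [d ycd]] := period_point_surj HOmega (repr y).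
have yE : y = piT (period_point Omega c d) by rewrite -ycd reprK.
move=> yB.
(* The arcs locate each entry up to an integer of its own; these integers are gathered into one
   matrix, the lattice correction for [y]. *)
have near (c0 c' : 'M[R]_(m, n)) : (forall k l, exists A B : 'M[int]_(m, n),
     expo_phase Omega A B (period_point Omega c d) = c' k l /\
     arc A B ((fl c0 k l)%:~R / N.+2%:R) (cos (N.+2%:R^-1 * (pi *+ 2))) y) ->
   exists z : 'M[int]_(m, n), forall k l, `|c0 k l - (c' k l - (z k l)%:~R)| < e.
  move=> H.
  have {}H k l : exists z : int, `|c0 k l - (c' k l - z%:~R)| < e.
    have [A [B [cE]]] := H k l.
    rewrite /arc /mkset yE torus_expoE // expoE cE -e2piD => /(e2pi_near_int N2)[z zP].
    exists z; apply: lt_trans Ne; have := flP c0 k l.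
    move: zP; set th := (_ %:~R / _); set r := _^-1.
    rewrite ltr_norml => /andP[? ?] /andP[? ?].
    by rewrite ltr_norml; apply/andP; split; lra.
  have /choice[z zP] : forall kl : 'I_m * 'I_n, exists z : int,
      `|c0 kl.1 kl.2 - (c' kl.1 kl.2 - z%:~R)| < e by move=> [k l]; exact: H.
  by exists (\matrix_(k, l) z (k, l)) => k l; rewrite mxE; exact: (zP (k, l)).
have [z zP] : exists z : 'M[int]_(m, n),
    forall k l, `|a k l - (c k l - (z k l)%:~R)| < e.
  apply: near => k l; exists (delta_mx k l), 0; rewrite expo_phase_l //; split=> //.
  by have [] := yB (k, l).
have [w wP] : exists z : 'M[int]_(m, n),
    forall k l, `|b k l - (d k l - (z k l)%:~R)| < e.
  apply: near => k l; exists 0, (delta_mx k l); rewrite expo_phase_r //; split=> //.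
  by have [] := yB (k, l).
(* The corrected representative of [y] has coordinates entrywise within [e] of $(a,b)$, inside the
   neighbourhood pulled back from [U]. *)
rewrite yE -(pi_period_point_int c d z w).
apply: (eU (c - map_mx intr z, d - map_mx intr w)); split; split=> // k l;
  by rewrite /ball /= !mxE.
Qed.

Lemma measurable_sub_L2_sets :
  @measurable _ T `<=` L2_sets vol real_trig_poly.
Proof.
have algA := bounded_algebra_trig_poly.
apply: (measurable_L2_sets algA (G := @open T)) => // U oU.
(* All boxes are enumerated by the natural numbers; codes of no box and boxes not contained in [U]
   contribute the empty set. *)
pose F (k : nat) : set T := if (choice.unpickle k : option (nat * IM)) is Some i
  then (if `[< box i.1 i.2 `<=` U >] then box i.1 i.2 else set0) else set0.
have -> : U = \bigcup_k F k.
  apply/seteqP; split=> [x Ux|x [k _]].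
    have [N [PQ [xB BU]]] := box_refine oU Ux.
    exists (choice.pickle (N, PQ)) => //; rewrite /F choice.pickleK /=.
    by case: asboolP.
  rewrite /F; case: choice.unpickle => // -[N PQ] /=.
  by case: asboolP => // BU /BU.
apply: (L2_sets_bigcup algA) => k; rewrite /F.
case: choice.unpickle => [[N PQ] /=|]; last exact: L2_sets0.
by case: ifP => _; [exact: L2_sets_box|exact: L2_sets0].
Qed.

Lemma trig_sum_fset (s : seq (R[i] * IM)) : exists (F : {fset IM}) (c : IM -> R[i]),
  forall x, trig_sum s x = \sum_(i <- F) c i * E i x.
Proof.
exists [fset i in map snd s]%fset, (fun i => \sum_(j <- s | j.2 == i) j.1) => x.
under [RHS]eq_bigr do rewrite mulr_suml.
rewrite (exchange_big_dep xpredT) //= /trig_sum big_seq [RHS]big_seq.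
apply: eq_bigr => j js.
rewrite -big_filter.
rewrite (eq_filter (a2 := pred1 j.2)); last by move=> i /=; rewrite eq_sym.
rewrite filter_pred1_uniq ?fset_uniq ?big_seq1 //.
by rewrite inE /=; apply/mapP; exists j.
Qed.

Lemma torus_expo_complete (f : T -> R[i]) : sq_integrable vol f ->
  forall eps : R, 0 < eps -> exists (F : {fset IM}) (c : IM -> R[i]),
    normL2 vol (fun x => f x - \sum_(i <- F) c i * E i x) < eps.
Proof.
move=> Hf eps eps0.
have algA := bounded_algebra_trig_poly.
have /sq_integrableP[mR mI fR fI] := Hf.
(* Real and imaginary parts are approximated separately, each with half of the squared error; the
   list for the imaginary part is then multiplied by $i$ and appended. *)
have e2 : 0 < eps ^+ 2 / 2 by rewrite divr_gt0 // exprn_gt0.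
have [_ /(_ _ e2)[p [s ps] fp]] := L2_closureT algA measurable_sub_L2_sets mR fR.
have [_ /(_ _ e2)[q [s' qs] fq]] := L2_closureT algA measurable_sub_L2_sets mI fI.
have [F [c Fc]] := trig_sum_fset
  (s ++ [seq ('i%C * j.1, j.2) | j <- s']).
exists F, c.
have gE x : f x - \sum_(i <- F) c i * E i x = f x - (p x +i* q x).
  rewrite -Fc /trig_sum big_cat big_map /=.
  have -> : \sum_(j <- s') 'i%C * j.1 * E j.2 x = 'i%C * trig_sum s' x.
    by rewrite mulr_sumr; apply: eq_bigr => j _; rewrite mulrA.
  change (f x - (trig_sum s x + 'i%C * trig_sum s' x) = f x - (p x +i* q x)).
  by rewrite -ps -qs; congr (_ - _); simpc.
have Hg : sq_integrable vol (fun x => f x - \sum_(i <- F) c i * E i x).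
  apply: sq_integrable_sub => //.
  by apply: sq_integrable_sum => i; exact: sq_integrable_torus_expo.
rewrite -(@ltr_pXn2r _ 2) ?nnegrE ?normL2_ge0 ?(ltW eps0) //.
rewrite sqr_normL2 // -lte_fin Re_innerL2 //.
have -> : (fun x => complex.Re (f x - \sum_(i <- F) c i * E i x)) =
    (fun x => complex.Re (f x) - p x).
  by apply/funext => x; rewrite gE raddfB.
have -> : (fun x => complex.Im (f x - \sum_(i <- F) c i * E i x)) =
    (fun x => complex.Im (f x) - q x).
  by apply/funext => x; rewrite gE raddfB.
rewrite (_ : eps ^+ 2 = eps ^+ 2 / 2 + eps ^+ 2 / 2); last by field.
by rewrite EFinD lteD.
Qed.

End Completeness.

(** * Eigenfunctions of the Laplacian *)

Section Eigenfunctions.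
Context {R : realType} {m n : nat} (Omega : 'M[R[i]]_n).
Hypothesis HOmega : siegel R n Omega.
Implicit Types (A B : 'M[int]_(m, n)) (D Z : 'M[R[i]]_(m, n)).

Lemma is_derive_circle (c : R[i]) (a b : R) :
  let f := fun t : R => c * (cos (a + t * b) +i* sin (a + t * b)) in
  is_derive (0 : R) 1 (fun t => complex.Re (f t)) (complex.Re ('i%C * b%:C * f 0)) /\
  is_derive (0 : R) 1 (fun t => complex.Im (f t)) (complex.Im ('i%C * b%:C * f 0)).
Proof.
have affE : is_derive (0 : R) 1 (fun t : R => a + t * b) b.
  apply: is_derive_eq; rewrite /GRing.scale /=; ring.
have cosE : is_derive (0 : R) 1 (fun t : R => cos (a + t * b)) (- sin a * b).
  apply: (is_derive_eq (is_derive1_comp (is_derive_cos _) affE)).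
  by rewrite mul0r addr0.
have sinE : is_derive (0 : R) 1 (fun t : R => sin (a + t * b)) (cos a * b).
  apply: (is_derive_eq (is_derive1_comp (is_derive_sin _) affE)).
  by rewrite mul0r addr0.
move=> f; split.
- rewrite (_ : (fun t => _) = (fun t => complex.Re c * cos (a + t * b) - complex.Im c * sin (a + t * b))).
    apply: is_derive_eq.
    rewrite /f mul0r addr0; case: (c) => u v /=; rewrite /GRing.scale /=; ring.
  by apply/funext => t; rewrite /f; case: (c).
- rewrite (_ : (fun t => _) = (fun t => complex.Re c * sin (a + t * b) + complex.Im c * cos (a + t * b))).
    apply: is_derive_eq.
    rewrite /f mul0r addr0; case: (c) => u v /=; rewrite /GRing.scale /=; ring.
  by apply/funext => t; rewrite /f; case: (c).
Qed.

(** The phase is real linear in $Z$, hence affine along each real line. *)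
Lemma expo_line (c : R[i]) A B D Z (t : R) :
  c * expo Omega A B (Z + t%:C *: D) =
  c * (cos (expo_phase Omega A B Z * (pi *+ 2) +
            t * (expo_phase Omega A B D * (pi *+ 2))) +i*
       sin (expo_phase Omega A B Z * (pi *+ 2) +
            t * (expo_phase Omega A B D * (pi *+ 2)))).
Proof. by rewrite expoE expo_phaseDz expo_phaseZz /e2pi mulrDl mulrA. Qed.

(** The logarithmic derivative of the character in direction [D]; it does not depend on the
    point. *)
Definition expo_slope A B D : R[i] :=
  'i%C * (expo_phase Omega A B D * (pi *+ 2))%:C.

Lemma rderivable_expo (c : R[i]) A B D Z :
  rderivable (fun Z => c * expo Omega A B Z) D Z.
Proof.
rewrite /rderivable; under eq_fun do rewrite expo_line.
under [X in _ /\ derivable X _ _]eq_fun do rewrite expo_line.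
by have [dR dI] := is_derive_circle c (expo_phase Omega A B Z * (pi *+ 2))
  (expo_phase Omega A B D * (pi *+ 2)).
Qed.

Lemma rderive_expo (c : R[i]) A B D :
  rderive (fun Z => c * expo Omega A B Z) D =
  (fun Z => expo_slope A B D * c * expo Omega A B Z).
Proof.
apply/funext => Z; rewrite /rderive; under eq_fun do rewrite expo_line.
under [X in _ +i* derive1 X _]eq_fun do rewrite expo_line.
have [dR dI] := is_derive_circle c (expo_phase Omega A B Z * (pi *+ 2))
  (expo_phase Omega A B D * (pi *+ 2)).
have ReImE (z : R[i]) : complex.Re z +i* complex.Im z = z by case: z.
rewrite !derive1E !derive_val; apply: (etrans (ReImE _)).
by rewrite -[RHS]mulrA expoE mul0r addr0.
Qed.

Lemma smooth_expo (c : R[i]) A B : smooth (fun Z => c * expo Omega A B Z).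
Proof.
(* The constant is generalized because each differentiation changes it. *)
move=> r; elim: r c => [|r IH] c /=.
  split=> //; exact: continuous_scale_expo.
split; first exact: continuous_scale_expo.
move=> k l D _; split; first by move=> Z; exact: rderivable_expo.
by rewrite rderive_expo; exact: IH.
Qed.

Lemma d_zbar_expo (c : R[i]) A B k l :
  d_zbar k l (fun Z => c * expo Omega A B Z) = (fun Z =>
    (expo_slope A B (dir_x k l) + 'i%C * expo_slope A B (dir_y k l)) / 2%:R * c *
    expo Omega A B Z).
Proof. by apply/funext => Z; rewrite /d_zbar !rderive_expo; ring. Qed.

Lemma d_z_expo (c : R[i]) A B k l :
  d_z k l (fun Z => c * expo Omega A B Z) = (fun Z =>
    (expo_slope A B (dir_x k l) - 'i%C * expo_slope A B (dir_y k l)) / 2%:R * c *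
    expo Omega A B Z).
Proof. by apply/funext => Z; rewrite /d_z !rderive_expo; ring. Qed.

Lemma eigenfunction_torus_expo A B : eigenfunction Omega (torus_expo Omega A B).
Proof.
rewrite /eigenfunction.
(* The factor 1 puts the lift in the form of a constant times a character, which is stable under
   differentiation. *)
have -> : (fun Z => torus_expo Omega A B (\pi_(torus m Omega)%qT Z)) =
    (fun Z => 1 * expo Omega A B Z).
  by apply/funext => Z; rewrite mul1r torus_expoE.
split; first exact: smooth_expo.
  by exists 0; rewrite torus_expo_neq0.
(* The symbol of the operator: each derivative is replaced by the constant by which it multiplies
   the character. *)
exists (\sum_(k < m) \sum_(p < n) \sum_(q < n) (Im_mx Omega p q)%:C *
  ((expo_slope A B (dir_x k q) - 'i%C * expo_slope A B (dir_y k q)) / 2%:R *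
   ((expo_slope A B (dir_x k p) + 'i%C * expo_slope A B (dir_y k p)) / 2%:R))) => Z.
rewrite /laplacian mulr_suml; apply: eq_bigr => k _.
rewrite mulr_suml; apply: eq_bigr => p _; rewrite mulr_suml; apply: eq_bigr => q _.
by rewrite d_zbar_expo d_z_expo torus_expoE // mulr1 mulrA.
Qed.

End Eigenfunctions.

Theorem theorem18p5 (R : realType) (m n : nat) (m_gt0 : (0 < m)%N)
    (n_gt0 : (0 < n)%N) (Omega : 'M[R[i]]_n) (HOmega : siegel R n Omega)
    (vol : probability (torus m Omega) R)
    (vol_invariant : translation_invariant vol) :
  complete_orthonormal_basis vol
    (fun AB : 'M[int]_(m, n) * 'M[int]_(m, n) =>
       torus_expo Omega AB.1 AB.2) /\
  (forall A B : 'M[int]_(m, n),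
     eigenfunction Omega (torus_expo Omega A B)) /\
  hilbert_direct_sum vol
    (fun AB : 'M[int]_(m, n) * 'M[int]_(m, n) =>
       lineL2 vol (torus_expo Omega AB.1 AB.2)).
Proof.
have basis := And3
  (fun AB : 'M[int]_(m, n) * 'M[int]_(m, n) =>
    sq_integrable_torus_expo HOmega vol AB.1 AB.2)
  (torus_expo_orthonormal HOmega vol_invariant)
  (@torus_expo_complete _ _ _ _ HOmega vol).
split; first exact: basis.
split; first exact: eigenfunction_torus_expo.
by apply: hilbert_direct_sum_lines; [case: basis|case: basis|exact: basis].
Qed.
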